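(* Let $X,Y$ be computable metric spaces. If $f:X\to Y$ is limit computable and uniformly continuous, then $f$ is computable relative to $0''$.
   Context: A computable metric space $(X,d,\alpha)$ is a metric space $(X,d)$ with a dense sequence $\alpha:\mathbb{N}\to X$ such that $d\circ(\alpha\times\alpha):\mathbb{N}^2\to\mathbb{R}$ is a computable (double) sequence of reals. It is represented by its Cauchy representation $\delta_X:\subseteq\mathbb{N}^{\mathbb{N}}\to X$, $\delta_X(p):=\lim_{n\to\infty}\alpha p(n)$ with $\mathrm{dom}(\delta_X)=\{p:(\forall k)(\forall n\geq k)\;d(\alpha p(n),\alpha p(k))<2^{-k}$ and $(\alpha p(n))_n$ converges$\}$. A function $f:X\to Y$ is limit computable, or computable relative to an oracle $q$, if it has a realizer with that property, i.e. such an $F:\subseteq\mathbb{N}^{\mathbb{N}}\to\mathbb{N}^{\mathbb{N}}$ with $\delta_YF(p)=f\delta_X(p)$ for all $p\in\mathrm{dom}(\delta_X)$. A partial function $F:\subseteq\mathbb{N}^{\mathbb{N}}\to\mathbb{N}^{\mathbb{N}}$ is computable if there is a Turing machine (infinite input tape, one-way output tape) that on each $p\in\mathrm{dom}(F)$ produces $F(p)$ in the long run; it is limit computable if there is a Turing machine with a two-way output tape (it may revise its output) that on each $p\in\mathrm{dom}(F)$ computes $F(p)$ such that each output position $n$ has, after finitely many steps, the content $F(p)(n)$ and is never changed again; it is computable relative to $q\in\mathbb{N}^{\mathbb{N}}$ if there is a computable $G$ with $F(p)=G\langle q,p\rangle$ for all $p\in\mathrm{dom}(F)$, where $\langle q,p\rangle(2n):=q(n)$,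 $\langle q,p\rangle(2n+1):=p(n)$. Nothing is required outside $\mathrm{dom}(F)$. For $p\in\mathbb{N}^{\mathbb{N}}$ the Turing jump $p'\in\mathbb{N}^{\mathbb{N}}$ is given by $p'(i)=1$ if the $i$-th Turing machine halts on input $p$, and $p'(i)=0$ otherwise; $0'$ is the jump of $000\dots$ (the halting problem) and $0'':=(0')'$. *)

(* Defs.v *)
From HB Require Import structures.
From mathcomp Require Import all_boot all_order all_algebra.
From mathcomp Require Import all_classical all_reals all_analysis.

Set Implicit Arguments.
Unset Strict Implicit.
Unset Printing Implicit Defensive.

Import Order.TTheory GRing.Theory Num.Theory.

Local Open Scope classical_set_scope.
Local Open Scope ring_scope.

Notation baire := (nat -> nat) (only parsing).

(** * Turing machines *)

(* [None] is the blank. *)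
Notation symbol := (option bool) (only parsing).

Variant move := Left | Stay | Right.

Definition move_code (m : move) : option bool :=
  match m with Left => Some false | Stay => None | Right => Some true end.

Definition move_decode (o : option bool) : move :=
  match o with Some false => Left | None => Stay | Some true => Right end.

Lemma move_codeK : cancel move_code move_decode.
Proof. by case. Qed.

HB.instance Definition _ := Countable.copy move (can_type move_codeK).

(* A machine with [k] work tapes also has a read-only input tape, whose cells
   carry bits, and an output tape.  A rule is a row of the transition table:
   in state [r_state], reading the symbols [r_in], [r_work], [r_out] under the
   heads, write the given symbols, move the heads and go to [r_next]. *)
Record rule (k : nat) := Rule {
  r_state : nat;
  r_in : bool;
  r_work : k.-tuple symbol;
  r_out : symbol;
  r_next : nat;
  r_in_move : move;
  r_work_act : k.-tuple (symbol * move);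
  r_out_act : symbol * move }.

Definition rule_code k (r : rule k) :=
  (r_state r, r_in r, r_work r, r_out r,
   (r_next r, r_in_move r, r_work_act r, r_out_act r)).

Definition rule_decode k
    (x : nat * bool * k.-tuple symbol * symbol *
         (nat * move * k.-tuple (symbol * move) * (symbol * move))) : rule k :=
  let: (q, i, w, o, (q', mi, aw, ao)) := x in Rule q i w o q' mi aw ao.

Lemma rule_codeK k : cancel (@rule_code k) (@rule_decode k).
Proof. by case. Qed.

HB.instance Definition _ k := Countable.copy (rule k) (can_type (@rule_codeK k)).

(* A finite transition table, together with the number of work tapes.  The
   start state is [0]; the first applicable rule is the one executed, and the
   machine halts when no rule is applicable.  The canonical [countType]
   structure ([pickle], [unpickle]) is an effective Goedel numbering of the
   machines, composed from [CodeSeq.code]. *)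
Definition machine := {k : nat & seq (rule k)}.

(* Tapes are infinite to the right; moving left from cell [0] has no effect. *)
Record tape := Tape { cell : nat -> symbol; head_pos : nat }.

Definition blank_tape := Tape (fun=> None) 0.

Definition move_head (m : move) (n : nat) : nat :=
  match m with Left => n.-1 | Stay => n | Right => n.+1 end.

Definition scan (t : tape) : symbol := cell t (head_pos t).

Definition act (a : symbol * move) (t : tape) : tape :=
  Tape (fun i => if i == head_pos t then a.1 else cell t i)
       (move_head a.2 (head_pos t)).

Record config (k : nat) := Config {
  c_state : nat;
  c_in_pos : nat;
  c_work : k.-tuple tape;
  c_out : tape }.

Definition init_config k : config k :=
  Config 0 0 [tuple of nseq k blank_tape] blank_tape.

(* The contents of the input tape: p is written in unary, as
   1^(p 0) 0 1^(p 1) 0 1^(p 2) 0 ... *)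
Definition unary (p : baire) (j : nat) : bool :=
  nth false (flatten [seq rcons (nseq (p i) true) false | i <- iota 0 j.+1]) j.

Definition applicable (p : baire) k (c : config k) (r : rule k) : bool :=
  [&& r_state r == c_state c, r_in r == unary p (c_in_pos c),
      r_work r == [tuple of map scan (c_work c)] & r_out r == scan (c_out c)].

Definition apply_rule k (r : rule k) (c : config k) : config k :=
  Config (r_next r) (move_head (r_in_move r) (c_in_pos c))
    [tuple act (tnth (r_work_act r) i) (tnth (c_work c) i) | i < k]
    (act (r_out_act r) (c_out c)).

Definition step (M : machine) (p : baire) (c : config (tag M)) :
    option (config (tag M)) :=
  omap (fun r => apply_rule r c) (ohead [seq r <- tagged M | applicable p c r]).

Definition run (M : machine) (p : baire) (t : nat) : config (tag M) :=
  iter t (fun c => odflt c (step p c)) (init_config (tag M)).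

Definition halts (M : machine) (p : baire) : Prop :=
  exists t, step p (run M p t) = None.

(* On input p, every cell of the output tape eventually carries, forever, the
   corresponding symbol of the unary representation of r. *)
Definition produces (M : machine) (p r : baire) : Prop :=
  forall j, \forall t \near \oo, cell (c_out (run M p t)) j = Some (unary r j).

(* The output tape is one-way if each step either does nothing on it or writes
   a bit and moves right; what has been written is then never revised. *)
Definition one_way (M : machine) : bool :=
  all (fun r => (r_out_act r == (None, Stay)) ||
                (isSome (r_out_act r).1 && ((r_out_act r).2 == Right)))
      (tagged M).

(** * Computability on Baire space *)

(* Partial functions on Baire space; the domain is where the value is a [Some]. *)
Notation pfun := (baire -> option baire) (only parsing).

Definition computable (F : pfun) : Prop :=
  exists2 M : machine, one_way M &
    forall p r, F p = Some r -> produces M p r.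

Definition limit_computable (F : pfun) : Prop :=
  exists M : machine, forall p r, F p = Some r -> produces M p r.

Definition bpair (q p : baire) : baire :=
  fun n => if odd n then p n./2 else q n./2.

Definition computable_relative_to (q : baire) (F : pfun) : Prop :=
  exists2 G : pfun, computable G &
    forall p r, F p = Some r -> G (bpair q p) = Some r.

Definition jump (p : baire) : baire :=
  fun i => if `[< exists2 M : machine, unpickle i = Some M & halts M p >]
           then 1%N else 0%N.

(** * Computable metric spaces *)

Definition computable_seq (c : baire) : Prop := computable (fun=> Some c).

Definition computable_fun3 (c : nat -> nat -> nat -> nat) : Prop :=
  exists2 e : baire, computable_seq e &
    forall i j k, c i j k = e (CodeSeq.code [:: i; j; k]).

(* The usual definition: rational approximations (-1)^s a / b, computable in
   i, j and k, with error at most 2^-k. *)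
Definition computable_double_seq (R : realType) (x : nat -> nat -> R) : Prop :=
  exists s a b : nat -> nat -> nat -> nat,
    [/\ computable_fun3 s, computable_fun3 a, computable_fun3 b &
     forall i j k, b i j k != 0%N /\
       `|(-1) ^+ s i j k * (a i j k)%:R / (b i j k)%:R - x i j| <= 2 ^- k].

Definition computable_metric_space (R : realType) (X : metricType R)
    (alpha : nat -> X) : Prop :=
  dense (range alpha) /\
  computable_double_seq (fun i j => mdist (alpha i) (alpha j)).

(* The graph of the Cauchy representation: p is in its domain, with value x. *)
Definition cauchy_rep (R : realType) (X : metricType R) (alpha : nat -> X)
    (p : baire) (x : X) : Prop :=
  (forall k n, (k <= n)%N -> mdist (alpha (p n)) (alpha (p k)) < 2 ^- k) /\
  (alpha \o p) @ \oo --> x.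

Definition realizer (R : realType) (X Y : metricType R) (alpha : nat -> X)
    (beta : nat -> Y) (F : pfun) (f : X -> Y) : Prop :=
  forall p x, cauchy_rep alpha p x ->
    exists2 r, F p = Some r & cauchy_rep beta r (f x).

Definition limit_computable_map (R : realType) (X Y : metricType R)
    (alpha : nat -> X) (beta : nat -> Y) (f : X -> Y) : Prop :=
  exists2 F : pfun, limit_computable F & realizer alpha beta F f.

Definition computable_map_relative_to (q : baire) (R : realType)
    (X Y : metricType R) (alpha : nat -> X) (beta : nat -> Y)
    (f : X -> Y) : Prop :=
  exists2 F : pfun, computable_relative_to q F & realizer alpha beta F f.

(* Main.v *)
Require Import Defs.
From mathcomp Require Import all_boot all_order all_algebra.
From mathcomp Require Import all_classical all_reals all_analysis.
From mathcomp Require Import zify lra.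

(* Let g(i, n) be the n-th entry of the name of f (alpha i) that a machine for f
   produces in the limit from the constant name i, i, i, ... of alpha i.  Both g
   and the rational approximations of the distances between points of the dense
   sequences are limits lim_t G(x, t) with G computable, so that for m to fail as
   a modulus of continuity of f for the precision 2^-n, on the points alpha i and
   up to constant factors, is a property of the form "exists a, forall t, ...",
   and so is g(i, n) = u.  Such properties are decided by 0'': the inner
   quantifier is a halting question for the input 0, and the outer one is then a
   halting question for the input 0', about machines whose Goedel numbers are
   computable from the parameters.  By uniform continuity a modulus m(n) exists,
   and 0'' finds it; given a name p of x, the sequence g(p(m(n)), n), for
   n = k + 5, is a name of f x.

   Everything computable here is computed by counter programs, which Turing
   machines execute with one work tape per register. *)

Set Implicit Arguments.
Unset Strict Implicit.
Unset Printing Implicit Defensive.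

Import Order.TTheory GRing.Theory Num.Theory.

Local Open Scope nat_scope.

(** * Counter programs and their terminating runs *)

Record store := Store { regs : nat -> nat; inpos : nat; outp : seq bool }.

Variant prim := Nop | Inc of nat | Dec of nat | InMove of move | Emit of bool.

Variant test := NonZero of nat | InputBit.

Inductive cmd := Do of prim | Seq of cmd & cmd | While of test & cmd.

Definition upd (f : nat -> nat) (r v : nat) : nat -> nat :=
  fun i => if i == r then v else f i.

Definition prim_sem (a : prim) (s : store) : store :=
  let: Store f i o := s in
  match a with
  | Nop => s
  | Inc r => Store (upd f r (f r).+1) i o
  | Dec r => Store (upd f r (f r).-1) i o
  | InMove m => Store f (move_head m i) o
  | Emit b => Store f i (rcons o b)
  end.

Definition test_sem (p : nat -> nat) (t : test) (s : store) : bool :=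
  match t with
  | NonZero r => regs s r != 0
  | InputBit => unary p (inpos s)
  end.

(** Only terminating runs are related; divergence is expressed on flow charts, which advance one
    instruction at a time. *)
Inductive exec (p : nat -> nat) : cmd -> store -> store -> Prop :=
| ExecDo a s : exec p (Do a) s (prim_sem a s)
| ExecSeq c1 c2 s1 s2 s3 : exec p c1 s1 s2 -> exec p c2 s2 s3 ->
    exec p (Seq c1 c2) s1 s3
| ExecDone t c s : ~~ test_sem p t s -> exec p (While t c) s s
| ExecLoop t c s1 s2 s3 : test_sem p t s1 -> exec p c s1 s2 ->
    exec p (While t c) s2 s3 -> exec p (While t c) s1 s3.

(** * Flow charts *)

(* [Br t n1 n0] goes to [n1] if the test succeeds, and to [n0] otherwise. *)
Variant instr := Act of prim & nat | Br of test & nat & nat.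

Definition instr0 := Act Nop 0.

(** Jump targets are absolute, [o] being the address of the first instruction. A loop has its test
    at [o], its body from [o.+1] on and a closing jump back to [o]. Every command is left at the
    address just past its code. *)
Fixpoint compile (c : cmd) (o : nat) : seq instr :=
  match c with
  | Do a => [:: Act a o.+1]
  | Seq c1 c2 => let l1 := compile c1 o in l1 ++ compile c2 (o + size l1)
  | While t c1 => let l1 := compile c1 o.+1 in
      Br t o.+1 (o.+1 + size l1).+1 :: rcons l1 (Act Nop o)
  end.

Definition fsem (p : nat -> nat) (i : instr) (s : store) : nat * store :=
  match i with
  | Act a n => (n, prim_sem a s)
  | Br t n1 n0 => (if test_sem p t s then n1 else n0, s)
  end.

Definition fstep (p : nat -> nat) (l : seq instr) (x : nat * store) :
    option (nat * store) :=
  if x.1 < size l then Some (fsem p (nth instr0 l x.1) x.2) else None.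

Definition frun p l n x := iter n (fun x => odflt x (fstep p l x)) x.

Lemma frunD p l m n x : frun p l (m + n) x = frun p l n (frun p l m x).
Proof. by rewrite /frun addnC iterD. Qed.

(** At least one step is demanded, so that [k] rounds of a loop take at least [k] steps. *)
Definition reaches p l (x y : nat * store) := exists n, frun p l n.+1 x = y.

Lemma reaches_trans p l x y z :
  reaches p l x y -> reaches p l y z -> reaches p l x z.
Proof. by move=> [m <-] [n <-]; exists (m.+1 + n); rewrite -addnS frunD. Qed.

Lemma reaches1 p l x y : fstep p l x = Some y -> reaches p l x y.
Proof. by move=> e; exists 0; rewrite /frun /= e. Qed.

(** A stuck state is never left, so a state that can still move has no stuck state before it. *)
Lemma fstep_Some p l x n y :
  frun p l n x = y -> fstep p l y -> forall m, m <= n -> fstep p l (frun p l m x).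
Proof.
move=> <- hy m le_mn; case e: (fstep p l (frun p l m x)) => [z|] //.
suff e' : frun p l n x = frun p l m x by rewrite e' e in hy.
rewrite -(subnKC le_mn) frunD; elim: (n - m) => //= i IH.
by rewrite /frun /= -/(frun p l i _) IH e.
Qed.

Definition placed (l L : seq instr) (o : nat) :=
  exists L1 L2, L = L1 ++ l ++ L2 /\ o = size L1.

Lemma placed_nth l L o i : placed l L o -> i < size l ->
  (nth instr0 L (o + i) = nth instr0 l i) /\ o + i < size L.
Proof.
move=> [L1 [L2 [-> ->]]] lt_i; rewrite nth_cat ltnNge leq_addr /= addKn.
by rewrite nth_cat lt_i !size_cat ltn_add2l ltn_addr.
Qed.

Lemma placed_catl l1 l2 L o : placed (l1 ++ l2) L o -> placed l1 L o.
Proof. by move=> [L1 [L2 [-> ->]]]; exists L1, (l2 ++ L2); rewrite -!catA. Qed.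

Lemma placed_catr l1 l2 L o : placed (l1 ++ l2) L o -> placed l2 L (o + size l1).
Proof.
move=> [L1 [L2 [-> ->]]]; exists (L1 ++ l1), L2.
by rewrite -!catA size_cat.
Qed.

Lemma placed_step l L o p i s : placed l L o -> i < size l ->
  reaches p L (o + i, s) (fsem p (nth instr0 l i) s).
Proof.
by move=> hl /(placed_nth hl)[e lt]; apply: reaches1; rewrite /fstep /= lt e.
Qed.

Lemma placed_loop t c L o : placed (compile (While t c) o) L o ->
  [/\ placed (compile c o.+1) L o.+1,
      forall p s, reaches p L (o, s)
        (if test_sem p t s then o.+1 else (o.+1 + size (compile c o.+1)).+1, s) &
      forall p s, reaches p L (o.+1 + size (compile c o.+1), s) (o, s)].
Proof.
rewrite /= -cat1s -cats1 => hl; split.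
- by move/placed_catr/placed_catl: hl; rewrite addn1.
- by move=> p s; have := placed_step p s (i := 0) (placed_catl hl) isT; rewrite addn0.
- move=> p s; move/placed_catr/placed_catr: hl => hl.
  have := placed_step p s (i := 0) hl isT.
  by rewrite /= addn0 addn1; case: s.
Qed.

Lemma exec_reaches p c s s' : exec p c s s' -> forall L o,
  placed (compile c o) L o -> reaches p L (o, s) (o + size (compile c o), s').
Proof.
elim=> {c s s'} [a s|c1 c2 s1 s2 s3 _ IH1 _ IH2|t c s ht|t c s1 s2 s3 ht _ IH1 _ IH2] L o hl.
- by have := placed_step p s (i := 0) hl isT; rewrite addn0 addn1.
- apply: reaches_trans (IH1 _ _ (placed_catl hl)) _.
  by rewrite /= size_cat addnA; apply: IH2; apply: placed_catr hl.
- have [_ /(_ p s) + _] := placed_loop hl; rewrite (negPf ht) /=.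
  by rewrite size_rcons addSn !addnS.
- have [h1 /(_ p s1) + /(_ p s2) h3] := placed_loop hl; rewrite ht => h2.
  apply: reaches_trans h2 _; apply: reaches_trans (IH1 _ _ h1) _.
  by apply: reaches_trans h3 _; apply: IH2.
Qed.

Lemma loop_reaches p t c L o (S : nat -> store) :
  placed (compile (While t c) o) L o ->
  (forall k, test_sem p t (S k)) -> (forall k, exec p c (S k) (S k.+1)) ->
  forall k, exists2 n, k <= n & frun p L n (o, S 0) = (o, S k).
Proof.
move=> hl hT hS; have [h1 h2 h3] := placed_loop hl.
elim=> [|k [n le_kn e]]; first by exists 0.
have [i ei] : reaches p L (o, S k) (o, S k.+1).
  apply: reaches_trans (h2 p (S k)) _; rewrite hT.
  by apply: reaches_trans (exec_reaches (hS k) h1) _; apply: h3.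
by exists (n + i.+1); rewrite ?frunD ?e // addnS ltnS (leq_trans le_kn) ?leq_addr.
Qed.

(** The loop head, where a step is always possible, is visited at arbitrarily late times. *)
Lemma loop_diverges p t c L o (S : nat -> store) n0 x :
  placed (compile (While t c) o) L o ->
  (forall k, test_sem p t (S k)) -> (forall k, exec p c (S k) (S k.+1)) ->
  frun p L n0 x = (o, S 0) -> forall n, fstep p L (frun p L n x).
Proof.
move=> hl hT hS e0 n; have [m le_nm e] := loop_reaches hl hT hS n.
apply: (@fstep_Some _ _ _ (n0 + m) (o, S n)); rewrite ?frunD ?e0 //; last first.
  by rewrite (leq_trans le_nm) ?leq_addl.
have [//|_] := placed_nth (i := 0) hl.
by rewrite addn0 /fstep /= => ->.
Qed.

(** * From flow charts to Turing machines *)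

Definition test_bound (t : test) := if t is NonZero r then r else 0.

Definition instr_bound (i : instr) :=
  match i with
  | Act (Inc r) _ | Act (Dec r) _ => r
  | Br t _ _ => test_bound t
  | _ => 0
  end.

Definition instr_prim (i : instr) := if i is Act a _ then a else Nop.

Definition reg_move (a : prim) (r : nat) : move :=
  match a with
  | Inc r' => if r == r' then Right else Stay
  | Dec r' => if r == r' then Left else Stay
  | _ => Stay
  end.

Definition input_move (a : prim) : move := if a is InMove m then m else Stay.

Definition output_act (a : prim) : symbol * move :=
  if a is Emit b then (Some b, Right) else (None, Stay).

(* A register is the position of the head on a work tape whose cell [0] alone
   is marked, so that scanning [Some true] means that the register is [0]. *)
Definition next_pc (i : instr) (b : bool) (w : seq symbol) : nat :=
  match i with
  | Act _ n => n
  | Br (NonZero r) n1 n0 => if nth None w r != Some true then n1 else n0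
  | Br InputBit n1 n0 => if b then n1 else n0
  end.

(** State [0] is kept for the initialisation, hence the shift [pc.+1]. Work tapes get back the
    symbol they show, and the output head always stands on a blank. *)
Definition code_rule k (pc : nat) (i : instr) (b : bool) (w : k.-tuple symbol) :
    rule k :=
  Rule pc.+1 b w None (next_pc i b w).+1 (input_move (instr_prim i))
    [tuple (tnth w j, reg_move (instr_prim i) j) | j < k]
    (output_act (instr_prim i)).

Definition code_rules k (l : seq instr) : seq (rule k) :=
  flatten [seq [seq code_rule pc (nth instr0 l pc) b w
                  | b <- [:: true; false], w <- enum {: k.-tuple symbol}]
             | pc <- iota 0 (size l)].

(* The parameter [a] is loaded by a chain of [a] states; [load_state n i] is the
   state in which [i] increments remain, and [1] the start of the program. *)
Definition load_state (n i : nat) := if i is 0 then 1 else n + i.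

(** Besides marking cell [0] of every work tape, this rule already increments register [0]. Its head
    therefore scans a blank during the whole loading phase, and the program starts with [a.+1] in
    register [0]. *)
Definition load_init k (n a : nat) (b : bool) : rule k :=
  Rule 0 b [tuple None | j < k] None (load_state n a) Stay
    [tuple (Some true, if j == 0 :> nat then Right else Stay) | j < k]
    (None, Stay).

Definition load_rule k (n i : nat) (b : bool) : rule k :=
  Rule (n + i.+1) b [tuple if j == 0 :> nat then None else Some true | j < k]
    None (load_state n i) Stay
    [tuple if j == 0 :> nat then (None, Right) else (Some true, Stay) | j < k]
    (None, Stay).

Fixpoint load_chain k (n a : nat) : seq (rule k) :=
  if a is i.+1 then
    [:: load_rule k n i true, load_rule k n i false & load_chain k n i]
  else [::].

(** States [1] to [size l] belong to the instructions, [(size l).+1] is the exit, for which there is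
    no rule, and the loading states lie beyond it. *)
Definition table k (l : seq instr) (a : nat) : seq (rule k) :=
  let n := (size l).+1 in
  [:: load_init k n a true, load_init k n a false
    & load_chain k n a ++ code_rules k l].

Definition tapes (l : seq instr) : nat := (\max_(i < size l) instr_bound (nth instr0 l i)).+1.

(** The parameter is built into the table and not read from the input, so that a query to a jump can
    depend on it through the Goedel number. *)
Definition mach (l : seq instr) (a : nat) : machine :=
  existT (fun k => seq (rule k)) (tapes l) (table (tapes l) l a).

Lemma mem_load_chain k n a i b : i < a -> load_rule k n i b \in load_chain k n a.
Proof.
elim: a => // a IH; rewrite ltnS leq_eqVlt => /orP[/eqP ->|lt_i] /=.
  by case: b {IH}; rewrite !inE eqxx ?orbT.
by rewrite !inE IH ?orbT.
Qed.

Lemma load_chainP k n a r : r \in load_chain k n a ->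
  exists i b, i < a /\ r = load_rule k n i b.
Proof.
elim: a => //= a IH; rewrite !inE => /or3P[/eqP ->|/eqP ->|/IH[i [b [lt ->]]]].
- by exists a, true.
- by exists a, false.
- by exists i, b; split=> //; apply: ltnW.
Qed.

Lemma mem_code_rules k l pc b (w : k.-tuple symbol) : pc < size l ->
  code_rule pc (nth instr0 l pc) b w \in code_rules k l.
Proof.
move=> lt; apply/flatten_mapP; exists pc; first by rewrite mem_iota.
by apply/allpairsP; exists (b, w); split; rewrite ?mem_enum //; case: b.
Qed.

Lemma code_rulesP k l r : r \in code_rules k l ->
  exists pc b w, pc < size l /\ r = code_rule pc (nth instr0 l pc) b w.
Proof.
case/flatten_mapP=> pc; rewrite mem_iota => lt.
by case/allpairsP=> -[b w] [_ _ ->]; exists pc, b, w.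
Qed.

Lemma tableP k l a (r : rule k) : r \in table k l a ->
  let n := (size l).+1 in
  [\/ exists b, r = load_init k n a b,
      exists i b, i < a /\ r = load_rule k n i b |
      exists pc b w, pc < size l /\ r = code_rule pc (nth instr0 l pc) b w].
Proof.
rewrite !inE mem_cat => /or4P[/eqP ->|/eqP ->|/load_chainP|/code_rulesP] /=.
- by constructor 1; exists true.
- by constructor 1; exists false.
- by constructor 2.
- by constructor 3.
Qed.

Lemma mem_table_init k l a b : load_init k (size l).+1 a b \in table k l a.
Proof. by case: b; rewrite !inE eqxx ?orbT. Qed.

Lemma mem_table_load k l a i b : i < a ->
  load_rule k (size l).+1 i b \in table k l a.
Proof. by move=> lt; rewrite !inE mem_cat mem_load_chain ?orbT. Qed.

(** [step] takes the first applicable row; if state, input bit and work symbols single out one row,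
    the order of the table does not matter. *)
Lemma step_rule (M : machine) p (c : config (tag M)) r0 :
  r0 \in tagged M -> applicable p c r0 ->
  (forall r, r \in tagged M -> r_state r = r_state r0 -> r_in r = r_in r0 ->
     r_work r = r_work r0 -> r = r0) ->
  step p c = Some (apply_rule r0 c).
Proof.
move=> mem0 app0 uniq0; rewrite /step.
case e: [seq _ <- _ | _] => [|r s].
  by have := mem_filter (applicable p c) r0 (tagged M); rewrite e mem0 app0.
have : r \in [seq r <- tagged M | applicable p c r] by rewrite e mem_head.
rewrite mem_filter => /andP[/and4P[/eqP r1 /eqP r2 /eqP r3 /eqP r4] rM] /=.
move/and4P: app0 => [/eqP q1 /eqP q2 /eqP q3 /eqP q4].
by rewrite (uniq0 r) //; congruence.
Qed.

Definition reg_tape (n : nat) : tape :=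
  Tape (fun i => if i == 0 then Some true else None) n.

Definition out_tape (o : seq bool) : tape :=
  Tape (fun i => if i < size o then Some (nth false o i) else None) (size o).

Definition conf k (q : nat) (s : store) : config k :=
  Config q (inpos s) [tuple reg_tape (regs s j) | j < k] (out_tape (outp s)).

Lemma tape_eq (t1 t2 : tape) :
  cell t1 =1 cell t2 -> head_pos t1 = head_pos t2 -> t1 = t2.
Proof. by case: t1 t2 => [c1 h1] [c2 h2] /= /funext -> ->. Qed.

Lemma act_reg_tape n m :
  act (scan (reg_tape n), m) (reg_tape n) = reg_tape (move_head m n).
Proof. by apply: tape_eq => //= i; case: eqP => // ->. Qed.

Lemma scan_reg_tape n : scan (reg_tape n) = if n == 0 then Some true else None.
Proof. by []. Qed.

Lemma act_out_stay o : act (None, Stay) (out_tape o) = out_tape o.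
Proof. by apply: tape_eq => //= i; case: eqP => // ->; rewrite ltnn. Qed.

Lemma act_out_emit o b : act (Some b, Right) (out_tape o) = out_tape (rcons o b).
Proof.
apply: tape_eq => [i|] /=; last by rewrite size_rcons.
by rewrite nth_rcons size_rcons ltnS; case: ltngtP.
Qed.

Lemma nth_scan k (f : nat -> nat) r : r < k ->
  nth None [tuple of map scan [tuple reg_tape (f j) | j < k]] r =
  if f r == 0 then Some true else None.
Proof.
move=> lt; have -> : r = Ordinal lt by [].
by rewrite -tnth_nth tnth_map tnth_mktuple.
Qed.

Lemma tapes_bound l pc : pc < size l -> instr_bound (nth instr0 l pc) < tapes l.
Proof.
move=> lt; exact: (@leq_bigmax 'I_(size l)
  (fun i => instr_bound (nth instr0 l i)) (Ordinal lt)).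
Qed.

Lemma step_mach_code l a p pc s : pc < size l ->
  step p (conf (tapes l) pc.+1 s : config (tag (mach l a))) =
  let: (pc', s') := fsem p (nth instr0 l pc) s in
  Some (conf (tapes l) pc'.+1 s').
Proof.
case: s => f pos o lt; set i := nth instr0 l pc.
set w := [tuple of map scan [tuple reg_tape (f j) | j < tapes l]].
rewrite (@step_rule (mach l a) p _ (code_rule pc i (unary p pos) w)); first last.
- move=> r /tableP[[b ->]|[j [b [_ ->]]]|[pc' [b [w' [lt' ->]]]]] //=.
    by rewrite addnS => -[e]; rewrite -e addSn -addnS -ltn_subRL subnn in lt.
  by move=> [->] -> ->.
- by rewrite /applicable /= !eqxx /= /scan /= ltnn.
- by rewrite !inE mem_cat mem_code_rules ?orbT.
have hb := tapes_bound lt; rewrite -/i in hb.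
rewrite /apply_rule /conf /=.
(* Whatever the instruction, the work tapes keep their contents and only heads move, so it suffices
   to know the moves. *)
have acts m : (forall j : 'I_(tapes l), reg_move (instr_prim i) j = m j) ->
  [tuple act (tnth [tuple (tnth w j, reg_move (instr_prim i) j) | j < tapes l] j)
      (tnth [tuple reg_tape (f j) | j < tapes l] j) | j < tapes l] =
  [tuple reg_tape (move_head (m j) (f j)) | j < tapes l].
  move=> em; apply: eq_from_tnth => j; rewrite !tnth_mktuple em.
  by rewrite -act_reg_tape /w tnth_map tnth_mktuple.
case: i hb acts => [[|r|r|m|b] n|[r|] n1 n0] /= hb acts; congr Some.
- by rewrite (acts (fun=> Stay)) // act_out_stay.
- rewrite (acts (fun j => if j == r :> nat then Right else Stay)) // act_out_stay.
  congr Config; apply: eq_from_tnth => j; rewrite !tnth_mktuple /upd.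
  by case: eqP => // ->.
- rewrite (acts (fun j => if j == r :> nat then Left else Stay)) // act_out_stay.
  congr Config; apply: eq_from_tnth => j; rewrite !tnth_mktuple /upd.
  by case: eqP => // ->.
- by rewrite (acts (fun=> Stay)) // act_out_stay.
- by rewrite (acts (fun=> Stay)) // act_out_emit.
- rewrite (acts (fun=> Stay)) // act_out_stay nth_scan //.
  by case: (f r == 0).
- by rewrite (acts (fun=> Stay)) // act_out_stay.
Qed.

Lemma step_mach_exit l a p s :
  step p (conf (tapes l) (size l).+1 s : config (tag (mach l a))) = None.
Proof.
rewrite /step; case e: [seq _ <- _ | _] => [|r rs] //.
have : r \in [seq r <- table (tapes l) l a |
                     applicable p (conf (tapes l) (size l).+1 s) r] by rewrite e mem_head.
rewrite mem_filter => /andP[/and4P[/eqP r1 _ _ _]].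
case/tableP=> [[b e1]|[j [b [_ e1]]]|[pc' [b [w' [lt' e1]]]]]; move: r1; rewrite e1 //=.
  by rewrite addnS addSn => -[/eqP]; rewrite -[X in _ == X]addn0 -addnS eqn_add2l.
by move=> -[e2]; rewrite e2 ltnn in lt'.
Qed.

Definition loading (a i : nat) : store :=
  Store (fun j => if j == 0 then (a - i).+1 else 0) 0 [::].

Lemma step_mach_init l a p :
  step p (init_config (tapes l) : config (tag (mach l a))) =
  Some (conf (tapes l) (load_state (size l).+1 a) (loading a a)).
Proof.
have scan0 : [tuple of map scan [tuple of nseq (tapes l) blank_tape]] =
    [tuple None | j < tapes l].
  by apply: eq_from_tnth => j; rewrite tnth_map tnth_nseq tnth_mktuple.
rewrite (@step_rule (mach l a) p _ (load_init (tapes l) (size l).+1 a (unary p 0))); first last.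
- move=> r /tableP[[b ->]|[j [b [_ ->]]]|[pc' [b [w' [lt' ->]]]]] //=.
  by move=> _ ->.
- by rewrite /applicable /= scan0 !eqxx.
- exact: mem_table_init.
congr Some; rewrite /apply_rule /conf /=; congr Config.
  apply: eq_from_tnth => j; rewrite !tnth_mktuple tnth_nseq /= subnn.
  by apply: tape_eq => //=; case: eqP.
by apply: tape_eq => //= i; case: eqP.
Qed.

Lemma step_mach_load l a p i : i < a ->
  step p (conf (tapes l) (load_state (size l).+1 i.+1) (loading a i.+1) :
            config (tag (mach l a))) =
  Some (conf (tapes l) (load_state (size l).+1 i) (loading a i)).
Proof.
move=> lt; set s := loading a i.+1.
have scan0 : [tuple of map scan [tuple reg_tape (regs s j) | j < tapes l]] =
    [tuple if j == 0 :> nat then None else Some true | j < tapes l].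
  apply: eq_from_tnth => j; rewrite tnth_map !tnth_mktuple scan_reg_tape /=.
  by case: (j == 0 :> nat).
rewrite (@step_rule (mach l a) p _ (load_rule (tapes l) (size l).+1 i (unary p 0))); first last.
- move=> r /tableP[[b ->]|[j [b [_ ->]]]|[pc' [b [w' [lt' ->]]]]] //=.
    by move/addnI=> [->] ->.
  by rewrite addSn => -[e]; rewrite e -ltn_subRL subnn in lt'.
- by rewrite /applicable /= scan0 !eqxx.
- exact: mem_table_load.
congr Some; rewrite /apply_rule /conf /=; congr Config; last exact: act_out_stay.
apply: eq_from_tnth => j; rewrite !tnth_mktuple subnS prednK ?subn_gt0 //.
have a_i : (a - i == 0) = false by rewrite subn_eq0 leqNgt lt.
apply: tape_eq => /= [k|]; last by case: (j == 0 :> nat).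
by case: (j == 0 :> nat) => /=; case: eqP => // ->; rewrite ?a_i.
Qed.

Definition start (a : nat) : store := loading a 0.

Lemma run_mach_start l a p :
  run (mach l a) p a.+1 = conf (tapes l) 1 (start a).
Proof.
have : forall i, i <= a -> run (mach l a) p i.+1 =
    conf (tapes l) (load_state (size l).+1 (a - i)) (loading a (a - i)).
  elim=> [|i IH] le_ia; first by rewrite subn0 /run /= step_mach_init.
  rewrite /run iterS -/(run _ _ _) IH ?(ltnW le_ia) // -subnSK //.
  by rewrite step_mach_load // subnSK // leq_subr.
by move/(_ a (leqnn a)); rewrite subnn.
Qed.

(** The bound keeps the program counter away from addresses whose states are loading states. At the
    exit both the flow chart and the machine stand still. *)
Lemma run_mach l a p t : (frun p l t (0, start a)).1 <= size l ->
  run (mach l a) p (a.+1 + t) =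
  let: (pc, s) := frun p l t (0, start a) in conf (tapes l) pc.+1 s.
Proof.
elim: t => [|t IH]; first by rewrite addn0 run_mach_start.
rewrite addnS /run iterS -/(run _ _ _) /frun iterS -/(frun _ _ _ _).
move: IH; case: (frun p l t _) => pc s /= IH.
rewrite {1 2}/fstep /=; case: ltnP => lt /= le'.
  by rewrite IH ?(ltnW lt) // step_mach_code //; case: fsem.
have {lt le'} e : pc = size l by apply/eqP; rewrite eqn_leq le'.
by move: IH; rewrite e => -> //; rewrite step_mach_exit.
Qed.

Lemma mach_halts l a p n s : frun p l n (0, start a) = (size l, s) ->
  halts (mach l a) p.
Proof.
move=> e; exists (a.+1 + n); rewrite run_mach e //=; exact: step_mach_exit.
Qed.

Lemma mach_diverges l a p : (forall n, fstep p l (frun p l n (0, start a))) ->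
  ~ halts (mach l a) p.
Proof.
move=> div [t ht]; suff : step p (run (mach l a) p (a.+1 + t)) = None.
  have := div t; rewrite /fstep; case: ltnP => // lt _.
  rewrite run_mach ?(ltnW lt) //; move: lt; case: frun => pc s /= lt.
  by rewrite step_mach_code //; case: fsem.
(* A halted machine keeps its configuration, so it is still halted [a.+1] steps later, when
   [run_mach] applies. *)
rewrite addnC; elim: a.+1 => [|i IH]; first by rewrite addn0.
by rewrite addnS /run iterS -/(run _ _ _) IH /= IH.
Qed.

Lemma mach_one_way l a : one_way (mach l a).
Proof.
apply/allP => r /tableP[[b ->]|[i [b [_ ->]]]|[pc [b [w [_ ->]]]]] //=.
by case: (nth _ _ _) => [[]|].
Qed.

(** * The unary input tape *)

Definition prefix_code (p : nat -> nat) (n : nat) : seq bool :=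
  flatten [seq rcons (nseq (p i) true) false | i <- iota 0 n].

Definition block_start (p : nat -> nat) (n : nat) : nat := \sum_(i < n) (p i).+1.

Lemma block_start0 p : block_start p 0 = 0.
Proof. exact: big_ord0. Qed.

Lemma prefix_codeS p n :
  prefix_code p n.+1 = prefix_code p n ++ rcons (nseq (p n) true) false.
Proof. by rewrite /prefix_code -addn1 iotaD map_cat flatten_cat /= cats0. Qed.

Lemma size_prefix_code p n : size (prefix_code p n) = block_start p n.
Proof.
elim: n => [|n IH]; first by rewrite block_start0.
by rewrite prefix_codeS size_cat IH /block_start big_ord_recr size_rcons size_nseq.
Qed.

Lemma block_startS p n : block_start p n.+1 = block_start p n + (p n).+1.
Proof. by rewrite /block_start big_ord_recr. Qed.

Lemma leq_block_start p n : n <= block_start p n.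
Proof. by elim: n => // n IH; rewrite block_startS addnS ltnS (leq_trans IH) ?leq_addr. Qed.

(** Appending blocks does not change earlier bits, and since no block is empty, the [j.+1] blocks in
    the definition of [unary] do cover position [j]. *)
Lemma nth_prefix_code p n j : j < block_start p n ->
  nth false (prefix_code p n) j = unary p j.
Proof.
have mono m i : j < block_start p m ->
    nth false (prefix_code p (m + i)) j = nth false (prefix_code p m) j.
  move=> lt_j; elim: i => [|i <-]; rewrite ?addn0 // addnS prefix_codeS nth_cat.
  rewrite size_prefix_code; have -> // : j < block_start p (m + i).
  elim: i => [|i IH]; rewrite ?addn0 // addnS block_startS.
  by apply: leq_trans IH _; apply: leq_addr.
move=> lt_j; rewrite /unary -/(prefix_code p j.+1).
by rewrite -(mono n j.+1) // addnC mono // leq_block_start.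
Qed.

Lemma unary_block p n y : y <= p n -> unary p (block_start p n + y) = (y < p n).
Proof.
move=> le_y; rewrite -(@nth_prefix_code p n.+1); last first.
  by rewrite block_startS ltn_add2l ltnS.
rewrite prefix_codeS nth_cat size_prefix_code ltnNge leq_addr /= addKn.
by rewrite nth_rcons size_nseq nth_nseq; case: ltngtP le_y.
Qed.

(** * Functions computed by counter programs *)

Lemma exec_while p t c (S : nat -> store) n :
  (forall i, i < n -> test_sem p t (S i) /\ exec p c (S i) (S i.+1)) ->
  ~~ test_sem p t (S n) -> exec p (While t c) (S 0) (S n).
Proof.
elim: n S => [|n IH] S hS hn; first exact: ExecDone.
have [h1 h2] := hS 0 isT; apply: ExecLoop h1 h2 _.
by apply: (IH (fun i => S i.+1)) => // i lt_i; apply: hS.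
Qed.

Lemma exec_do p a s s' : prim_sem a s = s' -> exec p (Do a) s s'.
Proof. by move=> <-; apply: ExecDo. Qed.

Lemma exec_eq p c s s1 s2 : exec p c s s1 -> s1 = s2 -> exec p c s s2.
Proof. by move=> + <-. Qed.

Lemma updE f r v : upd f r v r = v.
Proof. by rewrite /upd eqxx. Qed.

Lemma upd_id f r v : f r = v -> upd f r v = f.
Proof. by move=> <-; apply/funext => j; rewrite /upd; case: eqP => // ->. Qed.

Definition clear r := While (NonZero r) (Do (Dec r)).

Lemma exec_clear p r f i o :
  exec p (clear r) (Store f i o) (Store (upd f r 0) i o).
Proof.
have := @exec_while p (NonZero r) (Do (Dec r))
  (fun k => Store (upd f r (f r - k)) i o) (f r).
rewrite subn0 subnn (upd_id (erefl (f r))); apply; last by rewrite /= updE.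
move=> k lt_k; rewrite /= updE subn_eq0 -ltnNge lt_k; split=> //.
apply: exec_do => /=; congr Store; apply/funext => j; rewrite /upd eqxx.
by case: eqP => // _; rewrite subnS.
Qed.

Definition transfer r r' := While (NonZero r) (Seq (Do (Dec r)) (Do (Inc r'))).

Lemma exec_transfer p r r' f i o : r != r' ->
  exec p (transfer r r') (Store f i o)
    (Store (upd (upd f r' (f r' + f r)) r 0) i o).
Proof.
move=> /eqP ne.
have := @exec_while p (NonZero r) (Seq (Do (Dec r)) (Do (Inc r')))
  (fun k => Store (upd (upd f r' (f r' + k)) r (f r - k)) i o) (f r).
rewrite subn0 subnn addn0 (upd_id (erefl (f r'))) (upd_id (erefl (f r))).
apply; last by rewrite /= updE.
move=> k lt_k; rewrite /= updE subn_eq0 -ltnNge lt_k; split=> //.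
apply: ExecSeq (ExecDo _ _ _) _.
apply: exec_do => /=; congr Store; apply/funext => j; rewrite /upd.
by repeat case: eqP => ?; subst => //; lia.
Qed.

Definition transfer2 r r1 r2 :=
  While (NonZero r) (Seq (Do (Dec r)) (Seq (Do (Inc r1)) (Do (Inc r2)))).

Lemma exec_transfer2 p r r1 r2 f i o : r != r1 -> r != r2 -> r1 != r2 ->
  exec p (transfer2 r r1 r2) (Store f i o)
    (Store (upd (upd (upd f r1 (f r1 + f r)) r2 (f r2 + f r)) r 0) i o).
Proof.
move=> /eqP ne1 /eqP ne2 /eqP ne3.
have := @exec_while p (NonZero r) (Seq (Do (Dec r)) (Seq (Do (Inc r1)) (Do (Inc r2))))
  (fun k => Store (upd (upd (upd f r1 (f r1 + k)) r2 (f r2 + k)) r (f r - k)) i o) (f r).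
rewrite subn0 subnn !addn0 !(upd_id (erefl (f _))).
apply; last by rewrite /= updE.
move=> k lt_k; rewrite /= updE subn_eq0 -ltnNge lt_k; split=> //.
apply: ExecSeq (ExecDo _ _ _) _; apply: ExecSeq (ExecDo _ _ _) _.
apply: exec_do => /=; congr Store; apply/funext => j; rewrite /upd.
by repeat case: eqP => ?; subst => //; lia.
Qed.

(* [e p s] depends on the oracle [p], which ranges over [D], and on the registers
   below [b].  Asking for a program at every base [b' >= b], with the registers
   from [b'] on free, makes [Comp] monotone in [b]: no program is relocated. *)
Definition Comp (D : (nat -> nat) -> Prop) (b : nat)
    (e : (nat -> nat) -> (nat -> nat) -> nat) : Prop :=
  (forall p s s', D p -> (forall j, j < b -> s j = s' j) -> e p s = e p s') /\
  forall b', b <= b' -> exists c, forall p s o,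
    D p -> (forall j, b' <= j -> s j = 0) ->
    exec p c (Store s 0 o) (Store (upd s b' (e p s)) 0 o).

Section Closure.
Variable D : (nat -> nat) -> Prop.
Local Notation Comp := (Comp D).

Lemma Comp_weak b b' e : b <= b' -> Comp b e -> Comp b' e.
Proof.
move=> le_bb' [h1 h2]; split=> [p s s' Dp hs|b2 le2].
  by apply: h1 => // j lt_j; apply: hs; apply: leq_trans lt_j le_bb'.
by apply: h2; apply: leq_trans le2.
Qed.

Lemma Comp_ext b e e' : (forall p s, D p -> e p s = e' p s) ->
  Comp b e -> Comp b e'.
Proof.
move=> ee [h1 h2]; split=> [p s s' Dp hs|b' /h2[c hc]].
  by rewrite -!ee //; apply: h1.
by exists c => p s o Dp hs; rewrite -ee //; apply: hc.
Qed.

Lemma Comp_zero b : Comp b (fun _ _ => 0).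
Proof.
split=> // b' le_b; exists (Do Nop) => p s o _ hs.
by apply: exec_do; rewrite upd_id ?hs.
Qed.

Lemma Comp_succ b e : Comp b e -> Comp b (fun p s => (e p s).+1).
Proof.
move=> [h1 h2]; split=> [p s s' Dp hs|b' /h2[c hc]]; first by rewrite (h1 p s s').
exists (Seq c (Do (Inc b'))) => p s o Dp hs.
apply: ExecSeq (hc _ _ _ Dp hs) _; apply: exec_do => /=.
by congr Store; apply/funext => j; rewrite /upd eqxx; case: eqP.
Qed.

Lemma Comp_const b n : Comp b (fun _ _ => n).
Proof. by elim: n => [|n]; [exact: Comp_zero | exact: Comp_succ]. Qed.

Lemma Comp_reg b i : i < b -> Comp b (fun _ s => s i).
Proof.
move=> lt_i; split=> [p s s' _ hs|b' le_b]; first exact: hs.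
(* Reading a register destroys it, so its value goes to two places and is restored from the second
   one. *)
exists (Seq (transfer2 i b' b'.+1) (transfer b'.+1 i)) => p s o _ hs.
apply: ExecSeq; first by apply: exec_transfer2; apply/eqP; lia.
apply: exec_eq; first by apply: exec_transfer; apply/eqP; lia.
congr Store; apply/funext => j; rewrite /upd.
have := hs b'; have := hs b'.+1; by repeat case: eqP => ?; subst => //; lia.
Qed.

(** The program skips [e p s] blocks of the input, then counts the ones of the next block in
    register [b']. Register [b'.+1] records the head position throughout, so that the head can be
    brought back to cell [0]. *)
Lemma Comp_oracle b e : Comp b e -> Comp b (fun p s => p (e p s)).
Proof.
move=> [e1 e2]; split=> [p s s' Dp hs|b' le_b]; first by rewrite (e1 p s s').
have [c h] := e2 b' le_b.
pose advance := Seq (Do (InMove Right)) (Do (Inc b'.+1)).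
exists (Seq c (Seq
  (While (NonZero b') (Seq (Do (Dec b')) (Seq (While InputBit advance) advance)))
  (Seq (While InputBit (Seq advance (Do (Inc b'))))
    (While (NonZero b'.+1) (Seq (Do (Dec b'.+1)) (Do (InMove Left))))))) => p s o Dp hs.
apply: ExecSeq (h _ _ _ Dp hs) _; move: (e p s) => x.
pose S v n := Store (upd (upd s b' v) b'.+1 n) n o.
have test1 v n : test_sem p (NonZero b'.+1) (S v n) = (n != 0).
  by rewrite /= updE.
have test0 v n : test_sem p (NonZero b') (S v n) = (v != 0).
  by rewrite /= /upd eqxx; have -> : (b' == b'.+1) = false by lia.
have step v n : exec p advance (S v n) (S v n.+1).
  apply: ExecSeq (ExecDo _ _ _) _; apply: exec_do => /=; congr Store.
  by apply/funext => j; rewrite /upd eqxx; case: eqP.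
have dec v n : exec p (Do (Dec b')) (S v n) (S v.-1 n).
  apply: exec_do => /=; congr Store; apply/funext => j; rewrite /upd.
  by do 6?case: eqP => ?; subst => //; lia.
have inc v n : exec p (Do (Inc b')) (S v n) (S v.+1 n).
  apply: exec_do => /=; congr Store; apply/funext => j; rewrite /upd.
  by do 6?case: eqP => ?; subst => //; lia.
have back v n : exec p (Seq (Do (Dec b'.+1)) (Do (InMove Left))) (S v n) (S v n.-1).
  apply: ExecSeq (ExecDo _ _ _) _; apply: exec_do => /=; congr Store.
  by apply/funext => j; rewrite /upd eqxx; case: eqP.
have -> : Store (upd s b' x) 0 o = S x 0.
  by congr Store; apply/funext => j; rewrite /upd; do 2?case: eqP => ?; subst => //;
    try lia; apply: hs.
have -> : Store (upd s b' (p x)) 0 o = S (p x) 0.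
  by congr Store; apply/funext => j; rewrite /upd; do 2?case: eqP => ?; subst => //;
    try lia; apply: hs.
apply: (@ExecSeq _ _ _ _ (S 0 (block_start p x))).
  have := @exec_while p (NonZero b')
    (Seq (Do (Dec b')) (Seq (While InputBit advance) advance))
    (fun k => S (x - k) (block_start p k)) x.
  rewrite subn0 subnn block_start0; apply; last by rewrite test0.
  move=> k lt_k; rewrite test0 subn_eq0 -ltnNge; split=> //.
  apply: ExecSeq (dec _ _) _; rewrite -subnS block_startS addnS.
  apply: ExecSeq _ (step _ _).
  have := @exec_while p InputBit advance
    (fun y => S (x - k.+1) (block_start p k + y)) (p k).
  rewrite addn0; apply; last by rewrite /= unary_block ?ltnn.
  by move=> y lt_y; rewrite addnS; split; rewrite ?/= ?unary_block // ltnW.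
apply: (@ExecSeq _ _ _ _ (S (p x) (block_start p x + p x))).
  have := @exec_while p InputBit (Seq advance (Do (Inc b')))
    (fun y => S y (block_start p x + y)) (p x).
  rewrite addn0; apply; last by rewrite /= unary_block ?ltnn.
  move=> y lt_y; rewrite addnS; split; first by rewrite /= unary_block // ltnW.
  exact: ExecSeq (step _ _) (inc _ _).
set N := block_start p x + p x.
have := @exec_while p (NonZero b'.+1) (Seq (Do (Dec b'.+1)) (Do (InMove Left)))
  (fun k => S (p x) (N - k)) N.
rewrite subn0 subnn; apply; last by rewrite test1.
by move=> k lt_k; rewrite test1 subn_eq0 -ltnNge subnS; split.
Qed.

(* The two phases of a search for a zero of [F p s]: [c1] evaluates the first
   candidate, [c2] passes to the next one. *)
Lemma Comp_search_step b b' (F : (nat -> nat) -> (nat -> nat) -> nat -> nat) :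
  b <= b' ->
  (forall b' e, b <= b' -> Comp b' e -> Comp b' (fun p s => F p s (e p s))) ->
  exists c1 c2, forall p s o, D p -> (forall j, b' <= j -> s j = 0) ->
    let S k := Store (upd (upd s b' k) b'.+1 (F p s k)) 0 o in
    exec p c1 (Store s 0 o) (S 0) /\ forall k, exec p c2 (S k) (S k.+1).
Proof.
move=> le_b HF.
have locF p s s' i : D p -> (forall j, j < b -> s j = s' j) -> F p s i = F p s' i.
  by have [+ _] := HF b _ (leqnn b) (Comp_const b i); exact.
have [_ /(_ _ (leqnn _)) [c h]] := HF b'.+1 (fun _ s => s b') (leqW le_b) (Comp_reg (leqnn _)).
exists c, (Seq (clear b'.+1) (Seq (Do (Inc b')) c)) => p s o Dp hs.
have run k : exec p c (Store (upd s b' k) 0 o)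
    (Store (upd (upd s b' k) b'.+1 (F p s k)) 0 o).
  apply: exec_eq; first apply: h => //.
    by move=> j lt_j; rewrite /upd; case: eqP => ?; [lia | apply: hs; lia].
  (* The candidate sits in [b'], which is not below [b], so it does not disturb the other arguments
     of [F]. *)
  rewrite updE; congr (Store (upd _ _ _) _ _); apply: locF => // j lt_j.
  by rewrite /upd; case: eqP => ?; [lia|].
move=> S; split=> [|k]; first by have := run 0; rewrite {1}upd_id ?hs.
apply: ExecSeq; first exact: exec_clear.
apply: ExecSeq (run k.+1); apply: exec_do => /=; congr Store.
apply/funext => j; rewrite /upd; have := hs b'.+1.
by do 7?case: eqP => ?; subst => //; lia.
Qed.

(** Unbounded search. It ends because a zero exists for every oracle in [D], and the value found
    there, [0], leaves the scratch register [b'.+1] clean. *)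
Lemma Comp_mu b m (F : (nat -> nat) -> (nat -> nat) -> nat -> nat) :
  (forall b' e, b <= b' -> Comp b' e -> Comp b' (fun p s => F p s (e p s))) ->
  (forall p s, D p -> F p s (m p s) = 0 /\ forall x, F p s x = 0 -> m p s <= x) ->
  Comp b m.
Proof.
move=> HF hm; split=> [p s s' Dp hs|b' le_b].
  have locF i : F p s i = F p s' i.
    by have [+ _] := HF b _ (leqnn b) (Comp_const b i); exact.
  have [h1 h2] := hm p s Dp; have [h1' h2'] := hm p s' Dp.
  by apply/eqP; rewrite eqn_leq h2 ?h2' // ?locF // -locF.
have [c1 [c2 h]] := Comp_search_step le_b HF.
exists (Seq c1 (While (NonZero b'.+1) c2)) => p s o Dp hs.
have /= [h1 h2] := h p s o Dp hs; have [m1 m2] := hm p s Dp.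
apply: ExecSeq h1 _; apply: exec_eq.
  apply: (@exec_while _ _ _ (fun k => Store (upd (upd s b' k) b'.+1 (F p s k)) 0 o)
    (m p s)) => [k lt_k|]; last by rewrite /= updE m1.
  split; last exact: h2.
  by rewrite /= updE; apply: contraTneq lt_k => /m2; rewrite -leqNgt.
congr Store; apply/funext => j; rewrite /upd m1; have := hs b'.+1.
by do 3?case: eqP => ?; subst => //; lia.
Qed.

(** Register [b'] counts down the remaining rounds, [b'.+1] counts up the index, [b'.+2] holds the
    accumulator, and the step function is evaluated at base [b'.+3]. *)
Lemma Comp_rec b n z (F : (nat -> nat) -> (nat -> nat) -> nat -> nat -> nat) :
  Comp b n -> Comp b z ->
  (forall b' ei ea, b <= b' -> Comp b' ei -> Comp b' ea ->
     Comp b' (fun p s => F p s (ei p s) (ea p s))) ->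
  Comp b (fun p s => nat_rect (fun=> nat) (z p s) (F p s) (n p s)).
Proof.
move=> [n1 n2] [z1 z2] HF.
have locF p s s' i a : D p -> (forall j, j < b -> s j = s' j) -> F p s i a = F p s' i a.
  have [+ _] := HF b _ _ (leqnn b) (Comp_const b i) (Comp_const b a).
  exact.
split=> [p s s' Dp hs|b' le_b].
  rewrite (n1 p s s') // (z1 p s s') //.
  by elim: (n p s') => //= m ->; apply: locF.
have [c1 h1] := n2 b' le_b.
have [c2 h2] := z2 b'.+1 (leqW le_b).
have [_ /(_ _ (leqnn _)) [c3 h3]] := HF b'.+3 (fun _ s => s b'.+1) (fun _ s => s b'.+2)
  (leqW (leqW (leqW le_b))) (Comp_reg (leqnSn _)) (Comp_reg (leqnn _)).
exists (Seq c1 (Seq c2 (Seq (transfer b'.+1 b'.+2) (Seq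
  (While (NonZero b') (Seq (Do (Dec b')) (Seq c3 (Seq (clear b'.+2)
    (Seq (transfer b'.+3 b'.+2) (Do (Inc b'.+1)))))))
  (Seq (clear b'.+1) (transfer b'.+2 b')))))) => p s o Dp hs.
apply: ExecSeq (h1 _ _ _ Dp hs) _.
apply: ExecSeq; first apply: h2 => //.
  by move=> j lt_j; rewrite /upd; case: eqP => [?|_]; [lia | apply: hs; lia].
apply: ExecSeq; first by apply: exec_transfer; apply/eqP; lia.
set N := n p s; pose A k := nat_rect (fun=> nat) (z p s) (F p s) k.
pose S k := Store (upd (upd (upd s b' (N - k)) b'.+1 k) b'.+2 (A k)) 0 o.
apply: ExecSeq.
  have -> : z p (upd s b' N) = z p s.
    by apply: z1 => // j lt_j; rewrite /upd; case: eqP => //; lia.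
  set s0 := Store _ _ _; have -> : s0 = S 0.
    congr Store; apply/funext => j; rewrite /upd.
    have := hs b'.+1; have := hs b'.+2; have := hs j.
    by repeat case: eqP => ?; subst => //=; rewrite /A /=; lia.
  have tS k : test_sem p (NonZero b') (S k) = (N - k != 0).
    rewrite /= /upd eqxx; have -> : (b' == b'.+2) = false by lia.
    by have -> : (b' == b'.+1) = false by lia.
  apply: (@exec_while _ _ _ S N) => [k lt_k|]; last by rewrite tS subnn.
  split; first by rewrite tS subn_eq0 -ltnNge.
  apply: ExecSeq (ExecDo _ _ _) _.
  apply: ExecSeq; first apply: h3 => //.
    by move=> j lt_j; rewrite /upd; do 4?case: eqP => ? //; try lia; apply: hs; lia.
  set v := F p _ _ _.
  have {}vE : v = A k.+1.
    rewrite /v /= /A /= -/(A k) (locF p _ s) // => [|j lt_j]; last first.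
      by rewrite /upd; do 4?case: eqP => ? //; lia.
    by congr (F p s _ _); rewrite /upd; do 4?case: eqP => ? //; lia.
  rewrite {}vE; apply: ExecSeq; first exact: exec_clear.
  apply: ExecSeq; first by apply: exec_transfer; apply/eqP; lia.
  apply: exec_do => /=; congr Store; apply/funext => j; rewrite /upd.
  have := hs b'.+3.
  by do 12?case: eqP => ?; subst => //; lia.
apply: ExecSeq; first exact: exec_clear.
apply: exec_eq; first by apply: exec_transfer; apply/eqP; lia.
congr Store; apply/funext => j; rewrite /upd -/(A N).
have := hs b'; have := hs b'.+1; have := hs b'.+2.
by do 12?case: eqP => ?; subst => //; lia.
Qed.

End Closure.

(** * Arithmetic *)

(** Closure under composition, uniformly in the domain and the base. Being type classes, these facts
    are found by the tactic [comp], which follows the shape of an expression. *)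
Class Comp1 (f : nat -> nat) := comp1 : forall D b e,
  Comp D b e -> Comp D b (fun p s => f (e p s)).

Class Comp2 (f : nat -> nat -> nat) := comp2 : forall D b e1 e2,
  Comp D b e1 -> Comp D b e2 -> Comp D b (fun p s => f (e1 p s) (e2 p s)).

Class Comp3 (f : nat -> nat -> nat -> nat) := comp3 : forall D b e1 e2 e3,
  Comp D b e1 -> Comp D b e2 -> Comp D b e3 ->
  Comp D b (fun p s => f (e1 p s) (e2 p s) (e3 p s)).

Ltac comp_bool := fail.

Ltac comp :=
  lazymatch goal with
  | |- forall _, _ => intros; comp
  | |- Comp _ _ _ => first
    [ eassumption
    | match goal with H : Comp ?D ?b ?e |- Comp ?D ?b' ?e =>
        apply: (Comp_weak _ H); lia end
    | exact: Comp_const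
    | apply: Comp_reg; lia
    | match goal with
      | |- Comp _ _ (fun p s => ?f (@?e1 p s) (@?e2 p s) (@?e3 p s)) =>
          let H := constr:(ltac:(typeclasses eauto) : Comp3 f) in
          apply: (@comp3 f H); comp
      end
    | match goal with
      | |- Comp _ _ (fun p s => ?f (@?e1 p s) (@?e2 p s)) =>
          let H := constr:(ltac:(typeclasses eauto) : Comp2 f) in
          apply: (@comp2 f H); comp
      end
    | match goal with
      | |- Comp _ _ (fun p s => ?f (@?e1 p s)) =>
          let H := constr:(ltac:(typeclasses eauto) : Comp1 f) in
          apply: (@comp1 f H); comp
      end
    | comp_bool
    | idtac ]
  | _ => idtac
  end.

#[export] Instance Comp1_succ : Comp1 succn.
Proof. by move=> D b e; apply: Comp_succ. Qed.

#[export] Instance Comp2_add : Comp2 addn.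
Proof.
move=> D b e1 e2 h1 h2.
apply: (Comp_ext (e := fun p s => nat_rect (fun=> nat) (e2 p s) (fun _ a => a.+1) (e1 p s))).
  by move=> p s _; elim: (e1 p s) => //= n ->; rewrite addSn.
by apply: (Comp_rec (F := fun _ _ _ a => a.+1)); comp.
Qed.

#[export] Instance Comp2_mul : Comp2 muln.
Proof.
move=> D b e1 e2 h1 h2.
apply: (Comp_ext (e := fun p s => nat_rect (fun=> nat) 0 (fun _ a => e2 p s + a) (e1 p s))).
  by move=> p s _; elim: (e1 p s) => //= n ->; rewrite mulSn.
by apply: (Comp_rec (F := fun p s _ a => e2 p s + a)); comp.
Qed.

#[export] Instance Comp2_exp : Comp2 expn.
Proof.
move=> D b e1 e2 h1 h2.
apply: (Comp_ext (e := fun p s => nat_rect (fun=> nat) 1 (fun _ a => e1 p s * a) (e2 p s))).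
  by move=> p s _; elim: (e2 p s) => //= n ->; rewrite expnS.
by apply: (Comp_rec (F := fun p s _ a => e1 p s * a)); comp.
Qed.

#[export] Instance Comp1_pred : Comp1 predn.
Proof.
move=> D b e h.
apply: (Comp_ext (e := fun p s => nat_rect (fun=> nat) 0 (fun i _ => i) (e p s))).
  by move=> p s _; case: (e p s).
by apply: (Comp_rec (F := fun p s i _ => i)); comp.
Qed.

#[export] Instance Comp2_sub : Comp2 subn.
Proof.
move=> D b e1 e2 h1 h2.
apply: (Comp_ext (e := fun p s => nat_rect (fun=> nat) (e1 p s) (fun _ a => a.-1) (e2 p s))).
  by move=> p s _; elim: (e2 p s) => [|n /= ->]; rewrite ?subn0 ?subnS.
by apply: (Comp_rec (F := fun p s _ a => a.-1)); comp.
Qed.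

#[export] Instance Comp2_leq : Comp2 (fun x y => nat_of_bool (x <= y)).
Proof.
move=> D b e1 e2 h1 h2; apply: (Comp_ext (e := fun p s => 1 - (e1 p s - e2 p s))).
  by move=> p s _; case: leqP; lia.
by comp.
Qed.

Lemma Comp_and D b (c1 c2 : (nat -> nat) -> (nat -> nat) -> bool) :
  Comp D b (fun p s => nat_of_bool (c1 p s)) ->
  Comp D b (fun p s => nat_of_bool (c2 p s)) ->
  Comp D b (fun p s => nat_of_bool (c1 p s && c2 p s)).
Proof.
move=> h1 h2; apply: (Comp_ext (e := fun p s => c1 p s * c2 p s)); last by comp.
by move=> p s _; rewrite mulnb.
Qed.

Lemma Comp_not D b (c : (nat -> nat) -> (nat -> nat) -> bool) :
  Comp D b (fun p s => nat_of_bool (c p s)) ->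
  Comp D b (fun p s => nat_of_bool (~~ c p s)).
Proof.
move=> h; apply: (Comp_ext (e := fun p s => 1 - c p s)); last by comp.
by move=> p s _; case: (c p s).
Qed.

#[export] Instance Comp2_eq : Comp2 (fun x y => nat_of_bool (x == y)).
Proof.
move=> D b e1 e2 h1 h2.
apply: (Comp_ext (e := fun p s => nat_of_bool ((e1 p s <= e2 p s) && (e2 p s <= e1 p s)))).
  by move=> p s _; rewrite eqn_leq.
by apply: Comp_and; apply: (comp2 (f := fun x y => nat_of_bool (x <= y))).
Qed.

Lemma Comp_if D b (c : (nat -> nat) -> (nat -> nat) -> bool) e1 e2 :
  Comp D b (fun p s => nat_of_bool (c p s)) -> Comp D b e1 -> Comp D b e2 ->
  Comp D b (fun p s => if c p s then e1 p s else e2 p s).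
Proof.
move=> hc h1 h2; have hn := Comp_not hc.
apply: (Comp_ext (e := fun p s => c p s * e1 p s + (~~ c p s) * e2 p s)).
  by move=> p s _; case: (c p s); rewrite mul0n mul1n ?addn0.
by comp.
Qed.

Ltac comp_bool ::=
  match goal with
  | |- Comp _ _ (fun p s => nat_of_bool (andb (@?c1 p s) (@?c2 p s))) =>
      apply: (Comp_and (c1 := c1) (c2 := c2)); comp
  | |- Comp _ _ (fun p s => nat_of_bool (negb (@?c p s))) =>
      apply: (Comp_not (c := c)); comp
  | |- Comp _ _ (fun p s => nat_of_bool (leq (@?e1 p s) (@?e2 p s))) =>
      apply: (comp2 (f := fun x y => nat_of_bool (x <= y))); comp
  | |- Comp _ _ (fun p s => nat_of_bool (eq_op (@?e1 p s) (@?e2 p s))) =>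
      apply: (comp2 (f := fun x y => nat_of_bool (x == y))); comp
  | |- Comp _ _ (fun p s => if _ then _ else _) => simple apply Comp_if; comp
  end.

Lemma Comp_sum D b n (F : (nat -> nat) -> (nat -> nat) -> nat -> nat) :
  Comp D b n ->
  (forall b' e, b <= b' -> Comp D b' e -> Comp D b' (fun p s => F p s (e p s))) ->
  Comp D b (fun p s => \sum_(i < n p s) F p s i).
Proof.
move=> hn HF.
apply: (Comp_ext (e := fun p s =>
  nat_rect (fun=> nat) 0 (fun i a => F p s i + a) (n p s))).
  move=> p s _; elim: (n p s) => [|m /= ->]; first by rewrite big_ord0.
  by rewrite big_ord_recr addnC.
apply: (Comp_rec (F := fun p s i a => F p s i + a)) => // [|b' ei ea le_b hi ha].
  by comp.
by have := HF b' ei le_b hi; comp.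
Qed.

#[export] Instance Comp2_dvd : Comp2 (fun d m => nat_of_bool (d %| m)).
Proof.
move=> D b e1 e2 h1 h2.
apply: (Comp_ext (e := fun p s =>
   nat_of_bool (0 < \sum_(k < (e2 p s).+1) (k * e1 p s == e2 p s)))).
  move=> p s _; congr nat_of_bool; rewrite lt0n sum_nat_eq0 negb_forall.
  apply/existsP/dvdnP => [[k]|[k e]]; rewrite /= ?eqb0 ?negbK.
    by move/eqP=> <-; exists k.
  case: (posnP (e1 p s)) => [e0|gt0].
    by exists ord0; rewrite e e0 !muln0.
  have lt_k : k < (e2 p s).+1 by rewrite ltnS e leq_pmulr.
  by exists (Ordinal lt_k); rewrite /= e eqb0 negbK.
apply: (comp2 (f := fun x y => nat_of_bool (x <= y))); first by comp.
by apply: (Comp_sum (F := fun p s k => nat_of_bool (k * e1 p s == e2 p s))); comp.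
Qed.

(** A quotient counts the multiples of the divisor among the numbers from [1] to the dividend. *)
#[export] Instance Comp2_div : Comp2 divn.
Proof.
move=> D b e1 e2 h1 h2.
apply: (Comp_ext (e := fun p s => \sum_(k < e1 p s) (e2 p s %| k.+1))).
  by move=> p s _; rewrite divn_count_dvd big_add1 big_mkord.
apply: (Comp_sum (F := fun p s k => nat_of_bool (e2 p s %| k.+1))) => // b' e le_b h.
by apply: (comp2 (f := fun x y => nat_of_bool (x %| y))); comp.
Qed.

#[export] Instance Comp2_mod : Comp2 modn.
Proof.
move=> D b e1 e2 h1 h2.
apply: (Comp_ext (e := fun p s => e1 p s - e1 p s %/ e2 p s * e2 p s)); last by comp.
by move=> p s _; rewrite {1}(divn_eq (e1 p s) (e2 p s)) addKn.
Qed.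

(** * Codes of sequences *)

(** The recursion step of [CodeSeq.code], used as a pairing function as well: the exponent of [2] is
    the head, the odd part encodes the tail. *)
Definition code_cons (x c : nat) : nat := 2 ^ x * c.*2.+1.
Definition code_head (z : nat) : nat := logn 2 z.
Definition code_tail (z : nat) : nat := (z %/ 2 ^ code_head z) %/ 2.

Lemma code_consE x s : CodeSeq.code (x :: s) = code_cons x (CodeSeq.code s).
Proof. by []. Qed.

Lemma code_consK x c : code_head (code_cons x c) = x.
Proof.
rewrite /code_head /code_cons lognM ?expn_gt0 // pfactorK //.
by rewrite logn_coprime ?addn0 // coprime2n /= odd_double.
Qed.

Lemma code_tailK x c : code_tail (code_cons x c) = c.
Proof.
rewrite /code_tail code_consK /code_cons mulKn ?expn_gt0 //.
by rewrite divn2 /= uphalf_double.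
Qed.

#[export] Instance Comp2_code_cons : Comp2 code_cons.
Proof.
move=> D b e1 e2 h1 h2.
by apply: (Comp_ext (e := fun p s => 2 ^ e1 p s * (e2 p s + e2 p s).+1)) => [p s _|];
  rewrite ?addnn //; comp.
Qed.

#[export] Instance Comp1_code_head : Comp1 code_head.
Proof.
move=> D b e h.
apply: (Comp_ext (e := fun p s => \sum_(k < (e p s).-1) (2 ^ k.+1 %| e p s))).
  move=> p s _; rewrite /code_head; case: (posnP (e p s)) => [->|gt0].
    by rewrite big_ord0.
  by rewrite logn_count_dvd // big_add1 big_mkord.
apply: (Comp_sum (F := fun p s k => nat_of_bool (2 ^ k.+1 %| e p s))) => [|b' e' le_b h'].
  by comp.
by apply: (comp2 (f := fun x y => nat_of_bool (x %| y))); comp.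
Qed.

#[export] Instance Comp1_code_tail : Comp1 code_tail.
Proof. by move=> D b e h; rewrite /code_tail; comp. Qed.

(** * Goedel numbers and the double jump *)

Lemma pickle_cons (T : countType) (x : T) s :
  pickle (x :: s) = code_cons (pickle x) (pickle s).
Proof. by []. Qed.

Lemma pickle_machE l a :
  pickle (mach l a) = code_cons (tapes l) (code_cons (pickle (table (tapes l) l a)) 0).
Proof. by []. Qed.

(** Only the two states of a rule will vary with the parameter; the other components have constant
    codes. *)
Lemma Comp_pickle_rule k D b q q' i (w : k.-tuple symbol) o m aw ao :
  Comp D b q -> Comp D b q' ->
  Comp D b (fun p s => pickle (Rule (q p s) i w o (q' p s) m aw ao)).
Proof.
move=> h h'.
pose pair x y := code_cons x (code_cons y 0).
pose code p s := pair
  (pair (pair (pair (q p s) (pickle i)) (pickle w)) (pickle o))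
  (pair (pair (pair (q' p s) (pickle m)) (pickle aw)) (pickle ao)).
by apply: (Comp_ext (e := code)) => //; rewrite /code /pair; comp.
Qed.

Definition goedel (l : seq instr) (a : nat) : nat := pickle (mach l a).

(** An s-m-n theorem: the code of the table arises by primitive recursion on the parameter, the
    loading rules being consed in front of the fixed code of the program's rules. *)
#[export] Instance Comp1_goedel l : Comp1 (goedel l).
Proof.
move=> D b e h; set k := tapes l; set n := (size l).+1.
have h_load : Comp D b (fun p s => load_state n (e p s)).
  apply: (Comp_ext (e := fun p s => if e p s == 0 then 1 else n + e p s)).
    by move=> p s _; case: (e p s).
  by comp.
pose chain p s := nat_rect (fun=> nat) (pickle (code_rules k l))
  (fun i c => code_cons (pickle (load_rule k n i true))
     (code_cons (pickle (load_rule k n i false)) c)) (e p s).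
have h_chain : Comp D b chain.
  apply: (Comp_rec (F := fun p s i c => code_cons (pickle (load_rule k n i true))
     (code_cons (pickle (load_rule k n i false)) c))) => [||b' ei ea le_b hi ha].
  - exact: h.
  - exact: Comp_const.
  have h_next : Comp D b' (fun p s => load_state n (ei p s)).
    apply: (Comp_ext (e := fun p s => if ei p s == 0 then 1 else n + ei p s)).
      by move=> p s _; case: (ei p s).
    by comp.
  have h_rule c : Comp D b' (fun p s => pickle (load_rule k n (ei p s) c)).
    by apply: Comp_pickle_rule; comp.
  have h1 := h_rule true; have h2 := h_rule false.
  apply: (comp2 (f := code_cons)); first exact: h1.
  by apply: (comp2 (f := code_cons)); first exact: h2.
have h_init c : Comp D b (fun p s => pickle (load_init k n (e p s) c)).
  by apply: Comp_pickle_rule; comp.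
apply: (Comp_ext (e := fun p s => code_cons k (code_cons
  (code_cons (pickle (load_init k n (e p s) true))
    (code_cons (pickle (load_init k n (e p s) false)) (chain p s))) 0))).
  move=> p s _; rewrite /goedel pickle_machE pickle_cons pickle_cons.
  suff -> : chain p s = pickle (load_chain k n (e p s) ++ code_rules k l) by reflexivity.
  rewrite /chain; elim: (e p s) => [|i IH]; first by reflexivity.
  by rewrite [LHS]/= IH -pickle_cons -pickle_cons.
have h1 := h_init true; have h2 := h_init false.
apply: (comp2 (f := code_cons)); first exact: Comp_const.
apply: (comp2 (f := code_cons)); last exact: Comp_const.
apply: (comp2 (f := code_cons)); first exact: h1.
by apply: (comp2 (f := code_cons)); first exact: h2.
Qed.

Lemma jump_goedel p l a : jump p (goedel l a) = `[< halts (mach l a) p >].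
Proof.
rewrite /jump /goedel; have -> : `[< exists2 M : machine,
    unpickle (pickle (mach l a)) = Some M & halts M p >] = `[< halts (mach l a) p >].
  apply: asbool_equiv_eq; rewrite pickleK; split=> [[M [<-]] //|h].
  by exists (mach l a).
by case: asboolP.
Qed.

(** One program searches for a zero of [F p z]; the parameter of the machine supplies [z]. *)
Lemma semidecidable (D : (nat -> nat) -> Prop) (F : (nat -> nat) -> nat -> nat -> nat) :
  (forall b e1 e2, Comp D b e1 -> Comp D b e2 ->
     Comp D b (fun p s => F p (e1 p s) (e2 p s))) ->
  exists l, forall p z, D p -> (halts (mach l z) p <-> exists a, F p z a = 0).
Proof.
(* The predecessor undoes the extra [1] with which register [0] starts. *)
move=> HF; pose G p (s : nat -> nat) a := F p (s 0).-1 a.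
have [|c1 [c2 h]] := @Comp_search_step D 1 1 G isT.
  move=> b e lt_b he; have h0 : Comp D b (fun p s => (s 0).-1) by comp.
  exact: HF h0 he.
pose c := Seq c1 (While (NonZero 2) c2); exists (compile c 0) => p z Dp.
set l := compile c 0.
have hl : placed l l 0 by exists [::], [::]; rewrite cats0.
have [|/= h1 h2] := h p (regs (start z)) [::] Dp; first by case.
have GE a : G p (regs (start z)) a = F p z a by rewrite /G /= subn0.
pose S k := Store (upd (upd (regs (start z)) 1 k) 2 (F p z k)) 0 [::].
have {}h1 : exec p c1 (start z) (S 0) by rewrite /S -GE.
have {}h2 k : exec p c2 (S k) (S k.+1) by rewrite /S -!GE.
have testS k : test_sem p (NonZero 2) (S k) = (F p z k != 0).
  by rewrite /= /upd eqxx.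
split=> [hz|[a Fa]].
  apply: contrapT => no_a; apply: mach_diverges hz.
  have [n] := exec_reaches h1 (placed_catl hl).
  rewrite add0n; apply: loop_diverges h2; first exact: placed_catr hl.
  by move=> k; rewrite testS; apply/eqP => Fk; apply: no_a; exists k.
have ex : exists a, F p z a == 0 by exists a; apply/eqP.
case: (ex_minnP ex) => m /eqP Fm minm.
have run : exec p c (start z) (S m).
  apply: ExecSeq h1 _; apply: exec_while => [k lt_k|]; last by rewrite testS Fm.
  rewrite testS; split=> //; apply: contraTneq lt_k => /eqP/minm.
  by rewrite -leqNgt.
by have [n] := exec_reaches run hl; rewrite add0n; apply: mach_halts.
Qed.

(** The machine of [l1] searches for a [t] refuting the pair coded by its parameter. With the first
    jump as input, the machine of [l2] searches for an [a] for which that search never ends. *)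
Lemma double_jump (X : nat -> nat -> nat -> nat) : Comp3 X ->
  exists2 e, Comp1 e & forall z,
    jump (jump (fun=> 0)) (e z) = `[< exists a, forall t, X z a t != 0 >].
Proof.
move=> hX; pose zero := (fun=> 0) : nat -> nat.
have [|l1 hl1] := @semidecidable (eq zero)
    (fun _ x t => X (code_head x) (code_tail x) t).
  by move=> b e1 e2 h1 h2; comp.
have hj x : (jump zero (goedel l1 x) == 0) =
    `[< forall t, X (code_head x) (code_tail x) t != 0 >].
  rewrite jump_goedel eqb0; apply/asboolPn/asboolP => [h t|h /hl1[//|t ht]].
    by apply/eqP => ht; apply: h; apply/hl1 => //; exists t.
  by have := h t; rewrite ht.
have [|l2 hl2] := @semidecidable (eq (jump zero))
    (fun p z a => p (goedel l1 (code_cons z a))).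
  by move=> b e1 e2 h1 h2; apply: Comp_oracle; comp.
exists (goedel l2) => [|z]; first exact: Comp1_goedel.
rewrite jump_goedel; congr nat_of_bool; apply: asbool_equiv_eq.
rewrite hl2 //; split=> -[a ha]; exists a.
  by move/eqP: ha; rewrite hj code_consK code_tailK => /asboolP.
by apply/eqP; rewrite hj code_consK code_tailK; apply/asboolP.
Qed.

(** * Arithmetic simulation of a machine *)

Lemma Comp_code D b (l : seq nat) (F : nat -> (nat -> nat) -> (nat -> nat) -> nat) :
  (forall j, Comp D b (F j)) ->
  Comp D b (fun p s => CodeSeq.code [seq F j p s | j <- l]).
Proof.
move=> hF; elim: l => [|j l IH]; first exact: Comp_const.
by have hj := hF j; apply: (comp2 (f := code_cons)).
Qed.

Lemma Comp_all D b (l : seq nat) (c : nat -> (nat -> nat) -> (nat -> nat) -> bool) :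
  (forall j, Comp D b (fun p s => nat_of_bool (c j p s))) ->
  Comp D b (fun p s => nat_of_bool (all (fun j => c j p s) l)).
Proof.
move=> hc; elim: l => [|j l IH]; first exact: Comp_const.
exact: (Comp_and (hc j) IH).
Qed.

Definition item (j z : nat) : nat := code_head (iter j code_tail z).

#[export] Instance Comp1_item j : Comp1 (item j).
Proof.
move=> D b e h; apply: (comp1 (f := code_head)).
by elim: j => //= j IH; apply: (comp1 (f := code_tail)).
Qed.

Lemma item_code s j : item j (CodeSeq.code s) = nth 0 s j.
Proof.
rewrite /item; elim: s j => [|x s IH] j.
  rewrite nth_nil; suff -> : iter j code_tail 0 = 0 by [].
  by elim: j => //= j ->.
by case: j => [|j]; rewrite code_consE ?code_consK // iterSr code_tailK IH.
Qed.

(** A tape becomes a number in base 3; blanks are zeros, so the empty tape is [0]. *)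
Definition digit (N i : nat) : nat := (N %/ 3 ^ i) %% 3.

#[export] Instance Comp2_digit : Comp2 digit.
Proof. by move=> D b e1 e2 h1 h2; rewrite /digit; comp. Qed.

Definition set_digit (N h v : nat) : nat := N - digit N h * 3 ^ h + v * 3 ^ h.

#[export] Instance Comp3_set_digit : Comp3 set_digit.
Proof. by move=> D b e1 e2 e3 h1 h2 h3; rewrite /set_digit; comp. Qed.

Lemma digit_set N h v i : v < 3 ->
  digit (set_digit N h v) i = if i == h then v else digit N i.
Proof.
(* [q] and [r] collect the digits above and below position [h]. *)
move=> lt_v; set q := N %/ 3 ^ h.+1; set r := N %% 3 ^ h.
have lt_r : r < 3 ^ h by rewrite ltn_mod expn_gt0.
have NE : N = (q * 3 + digit N h) * 3 ^ h + r.
  have -> : q * 3 + digit N h = N %/ 3 ^ h.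
    by rewrite /q expnSr divnMA /digit -divn_eq.
  exact: divn_eq.
have -> : set_digit N h v = (q * 3 + v) * 3 ^ h + r.
  rewrite /set_digit {1}NE; lia.
have pos3 n : 0 < 3 ^ n by rewrite expn_gt0.
have : digit N h < 3 by rewrite ltn_mod.
rewrite [in RHS]NE; move: (digit N h) q r lt_r {NE} => d q r lt_r lt_d.
rewrite /digit; case: (ltngtP i h) => [lt_i|lt_h|->].
- have [a ->] : exists a, h = a.+1 + i by exists (h - i.+1); lia.
  have E x : (x * 3 ^ (a.+1 + i) + r) %/ 3 ^ i %% 3 = r %/ 3 ^ i %% 3.
    by rewrite expnD mulnA divnMDl ?pos3 // expnSr mulnA -modnDml modnMl.
  by rewrite !E.
- have [a ->] : exists a, i = h + a.+1 by exists (i - h.+1); lia.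
  have E w : w < 3 -> ((q * 3 + w) * 3 ^ h + r) %/ 3 ^ (h + a.+1) = q %/ 3 ^ a.
    move=> lt_w; rewrite expnD divnMA divnMDl ?pos3 // (divn_small lt_r) addn0.
    by rewrite expnS divnMA divnMDl // (divn_small lt_w) addn0.
  by rewrite !E.
- by rewrite divnMDl ?pos3 // (divn_small lt_r) addn0 modnMDl modn_small.
Qed.

Definition sym_code (o : symbol) : nat :=
  match o with None => 0 | Some false => 1 | Some true => 2 end.

Lemma sym_code_inj : injective sym_code.
Proof. by do 2!case=> [[]|]. Qed.

Lemma sym_code_lt o : sym_code o < 3.
Proof. by case: o => [[]|]. Qed.

(* The output tape counts as one more work tape, the [k]-th one. *)
Definition tape_at k (c : config k) (j : nat) : tape := nth (c_out c) (c_work c) j.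
Definition sym_at k (r : rule k) (j : nat) : symbol := nth (r_out r) (r_work r) j.
Definition act_at k (r : rule k) (j : nat) : symbol * move :=
  nth (r_out_act r) (r_work_act r) j.

Definition rep_tape (N h : nat) (t : tape) : Prop :=
  h = head_pos t /\ forall i, digit N i = sym_code (cell t i).

Definition rep k (z : nat) (c : config k) : Prop :=
  [/\ item 0 z = c_state c, item 1 z = c_in_pos c &
      forall j, j <= k -> rep_tape (item j.*2.+2 z) (item j.*2.+3 z) (tape_at c j)].

(** The input simulated is the constant sequence [i], whose unary code has period [i.+1]; this
    explains the test on the input position. *)
Definition applicable_code k (r : rule k) (i z : nat) : bool :=
  [&& item 0 z == r_state r, (item 1 z %% i.+1 < i) == r_in r &
      all (fun j => digit (item j.*2.+2 z) (item j.*2.+3 z) == sym_code (sym_at r j))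
          (iota 0 k.+1)].

Definition apply_item k (r : rule k) (z j : nat) : nat :=
  match j with
  | 0 => r_next r
  | 1 => move_head (r_in_move r) (item 1 z)
  | j'.+2 => let a := act_at r j'./2 in
      if odd j' then move_head a.2 (item j z)
      else set_digit (item j z) (item j.+1 z) (sym_code a.1)
  end.

Definition apply_code k (r : rule k) (z : nat) : nat :=
  CodeSeq.code [seq apply_item r z j | j <- iota 0 k.+1.*2.+2].

(** Folding from the right lets the first applicable rule win, as in [step]; if there is none, the
    code stays as it is. *)
Definition step_code k (rs : seq (rule k)) (i z : nat) : nat :=
  foldr (fun r z' => if applicable_code r i z then apply_code r z else z') z rs.

Definition run_code (M : machine) (i t : nat) : nat :=
  nat_rect (fun=> nat) (CodeSeq.code [::]) (fun _ => step_code (tagged M) i) t.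

#[export] Instance Comp1_move_head m : Comp1 (move_head m).
Proof. by case: m => D b e h /=; [apply: (comp1 (f := predn)) | | apply: (comp1 (f := succn))]. Qed.

#[export] Instance Comp2_step_code k (rs : seq (rule k)) : Comp2 (step_code rs).
Proof.
move=> D b e1 e2 h1 h2; rewrite /step_code.
suff h z : Comp D b z ->
    Comp D b (fun p s => foldr (fun r z' => if applicable_code r (e1 p s) (e2 p s)
       then apply_code r (e2 p s) else z') (z p s) rs) by apply: h.
move=> hz; elim: rs => //= r rs IH; apply: Comp_if IH.
  apply: Comp_and; first by comp.
  apply: Comp_and; last by apply: Comp_all => j; comp.
  case: (r_in r).
    by apply: (Comp_ext (e := fun p s => item 1 (e2 p s) %% (e1 p s).+1 < e1 p s)) =>
      [p s _|]; [case: (_ < _) | comp].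
  by apply: (Comp_ext (e := fun p s => ~~ (item 1 (e2 p s) %% (e1 p s).+1 < e1 p s))) =>
    [p s _|]; [case: (_ < _) | comp].
apply: Comp_code => -[|[|j]] /=.
- exact: Comp_const.
- by comp.
by case: (odd j); comp.
Qed.

#[export] Instance Comp2_run_code M : Comp2 (run_code M).
Proof.
move=> D b e1 e2 h1 h2.
apply: (Comp_rec (F := fun p s _ z => step_code (tagged M) (e1 p s) z)) => //.
  exact: Comp_const.
by comp.
Qed.

Lemma unary_const i j : unary (fun=> i) j = (j %% i.+1 < i).
Proof.
rewrite {1}(divn_eq j i.+1).
have -> : j %/ i.+1 * i.+1 = block_start (fun=> i) (j %/ i.+1).
  by rewrite /block_start sum_nat_const card_ord.
by rewrite unary_block // -ltnS ltn_mod.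
Qed.

Lemma applicable_codeE k (r : rule k) i z c : rep z c ->
  applicable_code r i z = applicable (fun=> i) c r.
Proof.
move=> [z0 z1 zt]; rewrite /applicable_code /applicable z0 z1 unary_const.
rewrite [r_state r == _]eq_sym [r_in r == _]eq_sym; congr [&& _, _ & _].
transitivity (all (fun j => sym_at r j == scan (tape_at c j)) (iota 0 k.+1)).
  apply: eq_in_all => j; rewrite mem_iota add0n ltnS => /zt[-> ->].
  by rewrite (inj_eq sym_code_inj) eq_sym.
apply/allP/andP => [h|[/eqP h1 /eqP h2] j].
  split.
    apply/eqP/eq_from_tnth => j; have := h j.
    rewrite mem_iota add0n ltnS (ltnW (ltn_ord j)) => /(_ isT)/eqP.
    rewrite /sym_at -(tnth_nth _ _ j) => ->.
    by rewrite tnth_map /tape_at -tnth_nth.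
  have := h k; rewrite mem_iota add0n ltnS leqnn => /(_ isT).
  by rewrite /sym_at /tape_at !nth_default ?size_tuple.
rewrite mem_iota add0n ltnS /= leq_eqVlt => /orP[/eqP ->|lt_j].
  by rewrite /sym_at /tape_at !nth_default ?size_tuple // h2.
rewrite /sym_at /tape_at h1 /= (nth_map (c_out c)) ?size_tuple //.
Qed.

Lemma rep_apply k (r : rule k) z c : rep z c -> rep (apply_code r z) (apply_rule r c).
Proof.
move=> [z0 z1 zt].
have itemE j : j < k.+1.*2.+2 -> item j (apply_code r z) = apply_item r z j.
  by move=> lt_j; rewrite item_code (nth_map 0) ?size_iota // nth_iota.
split; rewrite ?itemE //= ?z1 // => j le_j.
rewrite itemE; last by lia.
rewrite itemE /=; last by lia.
rewrite !odd_double /= uphalf_double doubleK.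
have -> : tape_at (apply_rule r c) j = act (act_at r j) (tape_at c j).
  rewrite /tape_at /act_at; move: le_j; rewrite leq_eqVlt => /orP[/eqP ->|lt_j].
    by rewrite !nth_default ?size_tuple.
  have -> : j = Ordinal lt_j by [].
  by rewrite -!tnth_nth tnth_mktuple.
have [-> ht] := zt j le_j; split=> //= n.
by rewrite digit_set ?sym_code_lt // ht; case: eqP.
Qed.

Lemma rep_step (M : machine) i z c : rep z c ->
  rep (step_code (tagged M) i z) (odflt c (step (M := M) (fun=> i) c)).
Proof.
rewrite /step /step_code; move: (tagged M) c => rs c hz.
elim: rs => //= r rs IH; rewrite (applicable_codeE r i hz).
by case: applicable => //=; apply: rep_apply.
Qed.

Lemma rep_run M i t : rep (run_code M i t) (run M (fun=> i) t).
Proof.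
elim: t => [|t IH]; last by rewrite /run iterS; apply: rep_step.
(* All items of the empty list are [0] by default, which describes the initial configuration. *)
have item0 j : item j (run_code M i 0) = 0 by have := item_code [::] j; rewrite nth_nil.
split=> [||j le_j]; rewrite !item0 //.
have -> : tape_at (init_config (tag M)) j = blank_tape.
  by rewrite /tape_at /= nth_nseq; case: ifP.
by split=> // n; rewrite /digit div0n.
Qed.

(* Position [j] carries a [1] of the [n]-th block if the bit there is [1] and [n]
   zeros precede it; this ignores whatever stands behind the [n]-th block. *)
Definition zeros (d : nat -> bool) (j : nat) : nat := \sum_(l < j) ~~ d l.

Definition block_value (d : nat -> bool) (n L : nat) : nat :=
  \sum_(j < L) (d j && (zeros d j == n)).

Lemma zerosS d j : zeros d j.+1 = zeros d j + ~~ d j.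
Proof. exact: big_ord_recr. Qed.

Lemma leq_zeros d i j : i <= j -> zeros d i <= zeros d j.
Proof.
move=> /subnKC <-; elim: (j - i) => [|m IH]; rewrite ?addn0 // addnS zerosS.
by rewrite (leq_trans IH) ?leq_addr.
Qed.

Lemma block_start_mono r m n : m <= n -> block_start r m <= block_start r n.
Proof.
move=> /subnKC <-; elim: (n - m) => [|i IH]; rewrite ?addn0 // addnS block_startS.
by rewrite (leq_trans IH) ?leq_addr.
Qed.

Lemma block_ofP r n j : j < block_start r n.+1 ->
  exists m y, [/\ m <= n, y <= r m & j = block_start r m + y].
Proof.
elim: n => [|n IH] lt_j.
  by exists 0, j; move: lt_j; rewrite block_startS block_start0.
case: (ltnP j (block_start r n.+1)) => [/IH[m [y [le_m le_y e]]]|le_j].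
  by exists m, y; rewrite leqW.
exists n.+1, (j - block_start r n.+1); rewrite subnKC //; split=> //.
by rewrite leq_subLR -ltnS -addnS -block_startS.
Qed.

(** Positions past block [n] are preceded by more than [n] zeros and are not counted, whatever bits
    stand there. *)
Lemma block_value_unary (d : nat -> bool) (r : nat -> nat) n L :
  (forall j, j < block_start r n.+1 -> d j = unary r j) ->
  block_start r n.+1 <= L -> block_value d n L = r n.
Proof.
move=> hd le_L.
have hd' m y : m <= n -> y <= r m -> d (block_start r m + y) = (y < r m).
  move=> le_m le_y; rewrite hd ?unary_block //.
  apply: (@leq_trans (block_start r m.+1)).
    by rewrite block_startS addnS ltnS leq_add2l.
  exact: block_start_mono.
have hz m y : m <= n -> y <= r m -> zeros d (block_start r m + y) = m.
  elim: m y => [|m IHm] y le_m; elim: y => [|y IHy] le_y.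
  - by rewrite addn0 block_start0; apply: big_ord0.
  - by rewrite addnS zerosS IHy ?(ltnW le_y) // hd' ?le_y // ltnW.
  - by rewrite addn0 block_startS addnS zerosS IHm ?hd' ?ltnn ?addn1 // ltnW.
  - by rewrite addnS zerosS IHy ?(ltnW le_y) // hd' ?le_y ?addn0 // ltnW.
(* The positions counted are exactly the ones of block [n], an interval of length [r n]. *)
have zE j : d j && (zeros d j == n) = (block_start r n <= j < block_start r n + r n).
  case: (ltnP j (block_start r n.+1)) => [/block_ofP[m [y [le_m le_y ->]]]|le_j].
    rewrite hz // hd' //; move: le_m; rewrite leq_eqVlt => /orP[/eqP ->|lt_m].
      by rewrite eqxx andbT leq_addr ltn_add2l.
    rewrite (ltn_eqF lt_m) andbF; apply/esym/negP => /andP[+ _].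
    apply/negP; rewrite -ltnNge; apply: (@leq_trans (block_start r m.+1)).
      by rewrite block_startS addnS ltnS leq_add2l.
    exact: block_start_mono.
  have gt_z : n < zeros d j.
    apply: leq_trans (leq_zeros d le_j).
    by rewrite block_startS addnS zerosS hz // hd' // ltnn addn1.
  rewrite (gtn_eqF gt_z) andbF; apply/esym/negP => /andP[_].
  by apply/negP; rewrite -leqNgt (leq_trans _ le_j) // block_startS leq_add2l.
rewrite /block_value (eq_bigr (fun j : 'I_L =>
   nat_of_bool (block_start r n <= j < block_start r n + r n))) => [|j _]; last by rewrite zE.
move: le_L; rewrite block_startS => le_L; move: (block_start r n) (r n) le_L => a c le_L.
rewrite -(big_mkord xpredT (fun j => nat_of_bool (a <= j < a + c))).
rewrite (@big_cat_nat _ _ _ a) //=; last by lia.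
rewrite (@big_cat_nat _ _ _ (a + c) a L) //=; [|lia|lia].
rewrite big_nat_cond big1 => [|j]; last by lia.
rewrite [X in _ + (_ + X)]big_nat_cond [X in _ + (_ + X)]big1 => [|j]; last by lia.
rewrite (eq_big_nat _ _ (F2 := fun=> 1)) => [|j]; last by lia.
by rewrite sum_nat_const_nat; lia.
Qed.

(** The time [t] also bounds the part of the output tape that is read; item [(tag M).*2.+2] is the
    content of that tape. *)
Definition value (M : machine) (i n t : nat) : nat :=
  block_value (fun j => digit (item (tag M).*2.+2 (run_code M i t)) j == 2) n t.

#[export] Instance Comp3_value M : Comp3 (value M).
Proof.
move=> D b e1 e2 e3 h1 h2 h3; rewrite /value /block_value /zeros.
set k := (tag M).*2.+2.
apply: (Comp_sum (F := fun p s j => nat_of_bool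
  ((digit (item k (run_code M (e1 p s) (e3 p s))) j == 2) &&
   (\sum_(l < j) ~~ (digit (item k (run_code M (e1 p s) (e3 p s))) l == 2) == e2 p s)))) =>
  // b' e le_b h.
apply: Comp_and; first by comp.
apply: (comp2 (f := fun x y => nat_of_bool (x == y))); last by comp.
apply: (Comp_sum (F := fun p s l => nat_of_bool
  (~~ (digit (item k (run_code M (e1 p s) (e3 p s))) l == 2)))) => // b2 e' le_b' h'.
by comp.
Qed.

(** The blocks up to [n] occupy finitely many cells, which share a time from which they are all
    final. *)
Lemma value_limit M i r n : produces M (fun=> i) r ->
  exists T, forall t, T <= t -> value M i n t = r n.
Proof.
move=> hM.
have [T hT] : exists T, forall t, T <= t -> forall j, j < block_start r n.+1 ->
    cell (c_out (run M (fun=> i) t)) j = Some (unary r j).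
  elim: (block_start r n.+1) => [|B [T hT]]; first by exists 0.
  have [T' _ hT'] := hM B; exists (maxn T T') => t; rewrite geq_max => /andP[le1 le2] j.
  by rewrite ltnS leq_eqVlt => /orP[/eqP ->|/(hT t le1)//]; apply: hT'.
exists (maxn T (block_start r n.+1)) => t; rewrite geq_max => /andP[le1 le2].
apply: block_value_unary le2 => j lt_j.
have [_ _ /(_ (tag M) (leqnn _))[_ ->]] := rep_run M i t.
rewrite /tape_at nth_default ?size_tuple // hT //.
by case: (unary r j).
Qed.

(** * Metric estimates *)

Local Open Scope ring_scope.

Lemma cauchy_rep_const (R : realType) (X : metricType R) (alpha : nat -> X) i :
  cauchy_rep alpha (fun=> i) (alpha i).
Proof.
split=> [k n _|]; first by rewrite mdistxx invr_gt0 exprn_gt0.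
exact: cvg_cst.
Qed.

Lemma cauchy_rep_near (R : realType) (X : metricType R) (alpha : nat -> X) p x m e :
  cauchy_rep alpha p x -> 0 < e ->
  exists2 n, (m <= n)%N & mdist x (alpha (p n)) < e.
Proof.
move=> [_ /cvg_ball/(_ e)] h /h[N _ hN]; exists (maxn m N); first exact: leq_maxl.
by have := hN (maxn m N) (leq_maxr _ _); rewrite ballEmdist.
Qed.

Lemma cauchy_rep_dist (R : realType) (X : metricType R) (alpha : nat -> X) p x k :
  cauchy_rep alpha p x -> mdist x (alpha (p k)) <= 2 ^- k.
Proof.
move=> hp; apply/ler_addgt0Pl => e e0.
have [n le_kn lt_e] := cauchy_rep_near k hp e0.
apply: le_trans (metric_triangle _ (alpha (p n)) _) _.
by apply: lerD; apply: ltW => //; apply: hp.1.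
Qed.

Lemma exp2V_lt (R : realType) (e : R) : 0 < e -> exists m, 2 ^- m < e.
Proof.
move=> e0; have [N _ hN] := near_infty_natSinv_expn_lt (PosNum e0).
by exists N; have := hN N (leqnn N); rewrite /= div1r.
Qed.

(** The factor 3 is what passing the rational test of [violates] guarantees. *)
Lemma modulus_exists (R : realType) (X Y : metricType R) (f : X -> Y) n :
  unif_continuous f ->
  exists m, forall x y, mdist x y <= 3 * 2 ^- m -> mdist (f x) (f y) < 2 ^- n.
Proof.
move=> /unif_continuousP/(_ (2 ^- n)) [|d d0 hd].
  by rewrite invr_gt0 exprn_gt0.
have [m lt_m] := @exp2V_lt R (d / 3) ltac:(lra); exists m => x y le_xy.
have := hd (x, y); rewrite !ballEmdist /=; apply.
by apply: le_lt_trans le_xy _; lra.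
Qed.

(** Clearing denominators gives a comparison of natural numbers, which counter programs can
    decide. *)
Lemma ratio_test (R : realType) (a b c m : nat) : b != 0%N ->
  (a * 2 ^ m <= c * b)%N = (a%:R / b%:R <= c%:R * 2 ^- m :> R).
Proof.
move=> b0; have b_gt0 : 0 < b%:R :> R by rewrite ltr0n lt0n.
rewrite ler_pdivrMr // mulrAC ler_pdivlMr ?exprn_gt0 //.
by rewrite -natrX -!natrM ler_nat.
Qed.

(** A distance is nonnegative, so dropping a minus sign brings the approximation no farther from
    it. *)
Lemma approx_unsigned (R : realType) (s : nat) (q d e : R) : 0 <= q -> 0 <= d ->
  `|(-1) ^+ s * q - d| <= e -> `|q - d| <= e.
Proof.
move=> q0 d0; rewrite -signr_odd; case: (odd s); rewrite ?mul1r //= expr1 mulN1r.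
by rewrite !ler_norml => /andP[h1 h2]; lra.
Qed.

(** The modulus costs [7 * 2 ^- n] and the entry [g i n] another [2 ^- n]; at [n = k + 5] the sum
    [8 * 2 ^- n] is a quarter of [2 ^- k]. *)
Lemma cauchy_output (R : realType) (X Y : metricType R) (alpha : nat -> X)
    (beta : nat -> Y) (f : X -> Y) (g : nat -> nat -> nat) (mo : nat -> nat) p x :
  unif_continuous f ->
  (forall i, cauchy_rep beta (g i) (f (alpha i))) ->
  (forall n i j, mdist (alpha i) (alpha j) < 2 ^- mo n ->
     mdist (f (alpha i)) (f (alpha j)) <= 7 * 2 ^- n) ->
  cauchy_rep alpha p x ->
  cauchy_rep beta (fun k => g (p (mo (k + 5))) (k + 5))%N (f x).
Proof.
move=> uf hg hmo hp; set y := fun k => _.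
(* The modulus speaks of points of the dense sequence only, so [x] is replaced by a late entry of
   its name, at the cost of an arbitrarily small [e]. *)
have D1 n : mdist (f x) (f (alpha (p (mo n)))) <= 7 * 2 ^- n.
  apply/ler_addgt0Pl => e e0.
  have [d d0 hd] := (unif_continuousP f).1 uf e e0.
  have [l le_l lt_d] := cauchy_rep_near (mo n) hp d0.
  apply: le_trans (metric_triangle _ (f (alpha (p l))) _) _; apply: lerD.
    by have := hd (x, alpha (p l)); rewrite !ballEmdist /= => /(_ lt_d)/ltW.
  by apply: hmo; apply: hp.1.
have D2 k : mdist (f x) (beta (y k)) <= 2 ^- k / 4.
  have le8 : mdist (f x) (beta (y k)) <= 8 * 2 ^- (k + 5)%N.
    apply: le_trans (metric_triangle _ (f (alpha (p (mo (k + 5)%N)))) _) _.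
    have := D1 (k + 5)%N; have := cauchy_rep_dist (k + 5)%N (hg (p (mo (k + 5)%N))).
    by rewrite -/(y k); lra.
  by apply: le_trans le8 _; rewrite exprD invfM; lra.
split=> [k n le_kn|].
  have le_pow : 2 ^- n <= 2 ^- k :> R.
    by rewrite lef_pV2 ?posrE ?exprn_gt0 // ler_eXn2l // ltr1n.
  have k0 : 0 < 2 ^- k :> R by rewrite invr_gt0 exprn_gt0.
  apply: le_lt_trans (metric_triangle _ (f x) _) _; rewrite metric_sym.
  by have := D2 n; have := D2 k; lra.
apply/cvg_ballP => e e0; have [N lt_N] := exp2V_lt e0.
exists N => // k /= le_Nk; rewrite ballEmdist /=; apply: le_lt_trans (D2 k) _.
have le_pow : 2 ^- k <= 2 ^- N :> R.
  by rewrite lef_pV2 ?posrE ?exprn_gt0 // ler_eXn2l // ltr1n.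
have k0 : 0 < 2 ^- k :> R by rewrite invr_gt0 exprn_gt0.
lra.
Qed.

Local Open Scope nat_scope.

(** * Output of a computed sequence *)

Lemma outp_prefix p l n m x :
  prefix (outp (frun p l n x).2) (outp (frun p l (n + m) x).2).
Proof.
elim: m => [|m IH]; first by rewrite addn0 prefix_refl.
apply: prefix_trans IH _; rewrite addnS /frun iterS -/(frun _ _ _ _).
case: (frun p l (n + m) x) => pc [f i o]; rewrite /fstep /=.
case: ifP => _ /=; last exact: prefix_refl.
by case: (nth _ _ _) => [[|r|r|b|b] n'|t n1 n0] /=; rewrite ?prefix_refl ?prefix_rcons.
Qed.

(** Output only grows, so a prefix once written persists; a run that never gets stuck stays within
    the range of [run_mach]. *)
Lemma produces_mach l p a r : (forall n, fstep p l (frun p l n (0, start a))) ->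
  (forall k, exists n, outp (frun p l n (0, start a)).2 = prefix_code r k) ->
  produces (mach l a) p r.
Proof.
move=> alive hout j; have [n hn] := hout j.+1.
exists (a.+1 + n) => // t /= le_t.
rewrite -(subnKC le_t) -addnA run_mach; last first.
  by have := alive (n + (t - (a.+1 + n))); rewrite /fstep; case: ltnP => // /ltnW.
have := outp_prefix p l n (t - (a.+1 + n)) (0, start a); rewrite hn.
case: (frun p l (n + _) _) => pc s /= /prefixP[rest ->].
have lt_j : j < block_start r j.+1 by apply: leq_block_start.
rewrite size_cat size_prefix_code ltn_addr // nth_cat size_prefix_code lt_j.
by rewrite nth_prefix_code.
Qed.

(** Register [0] holds the index plus one. It starts at [1] and is never [0], so it also serves as
    the test of the endless loop. *)
Lemma computes_sequence (D : (nat -> nat) -> Prop) (u : (nat -> nat) -> nat -> nat) :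
  (forall b e, Comp D b e -> Comp D b (fun p s => u p (e p s))) ->
  exists2 M : machine, one_way M & forall p, D p -> produces M p (u p).
Proof.
move=> hu; have [|_ /(_ 1 isT) [c hc]] := hu 1 (fun _ s => (s 0).-1).
  by comp.
pose emit := While (NonZero 1) (Seq (Do (Dec 1)) (Do (Emit true))).
pose body := Seq c (Seq emit (Seq (Do (Emit false)) (Do (Inc 0)))).
set l := compile (While (NonZero 0) body) 0.
exists (mach l 0) => [|p Dp]; first exact: mach_one_way.
have hl : placed (compile (While (NonZero 0) body) 0) l 0 by exists [::], [::]; rewrite cats0.
pose R k y := fun j => if j == 0 then k.+1 else if j == 1 then y else 0.
pose S k := Store (R k 0) 0 (prefix_code (u p) k).
have start0 : start 0 = S 0.
  by congr Store; apply/funext => j; rewrite /R; case: (j == 0); case: (j == 1).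
have testS k : test_sem p (NonZero 0) (S k) by [].
have stepS k : exec p body (S k) (S k.+1).
  apply: ExecSeq; first by apply: hc => // -[|[|j]].
  have -> : upd (R k 0) 1 (u p (R k 0 0).-1) = R k (u p k).
    by apply/funext => -[|[|j]].
  apply: (@ExecSeq _ _ _ _
    (Store (R k 0) 0 (prefix_code (u p) k ++ nseq (u p k) true))); last first.
    apply: ExecSeq (ExecDo _ _ _) _; apply: exec_do.
    rewrite /S prefix_codeS /= rcons_cat; congr Store.
    by apply/funext => -[|[|j]].
  have := @exec_while p (NonZero 1) (Seq (Do (Dec 1)) (Do (Emit true)))
    (fun i => Store (R k (u p k - i)) 0 (prefix_code (u p) k ++ nseq i true)) (u p k).
  rewrite subn0 subnn cats0; apply=> // i lt_i; rewrite /= subn_eq0 -ltnNge.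
  split=> //; apply: ExecSeq (ExecDo _ _ _) _; apply: exec_do => /=.
  have -> : rcons (prefix_code (u p) k ++ nseq i true) true =
      prefix_code (u p) k ++ nseq i.+1 true.
    by rewrite rcons_cat -cats1 -[[:: true]]/(nseq 1 true) -nseqD addn1.
  by congr Store; apply/funext => -[|[|j]]; rewrite /upd /R //= subnS.
apply: produces_mach.
  have e0 : frun p l 0 (0, start 0) = (0, S 0) by rewrite start0.
  exact: loop_diverges hl testS stepS e0.
move=> k; have [n _ e] := loop_reaches hl testS stepS k.
by exists n; rewrite start0 e.
Qed.

(** * The modulus of continuity *)

(** This is [CodeSeq.code [:: i; j; k]], the argument format of [computable_fun3]. *)
Definition triple (i j k : nat) : nat := code_cons i (code_cons j (code_cons k 0)).

#[export] Instance Comp3_triple : Comp3 triple.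
Proof. by move=> D b e1 e2 e3 h1 h2 h3; rewrite /triple; comp. Qed.

(** The machine works for every input; it is run on the constant sequence [0], so that distances
    become limits like the values of [g]. *)
Lemma fun3_limit c : computable_fun3 c -> exists M, forall i j k,
  exists T, forall t, T <= t -> value M 0 (triple i j k) t = c i j k.
Proof.
move=> [e [M _ hM] hc]; exists M => i j k; rewrite hc.
by apply: value_limit; apply: hM.
Qed.

Lemma bpair_even q p n : bpair q p n.*2 = q n.
Proof. by rewrite /bpair odd_double doubleK. Qed.

Lemma bpair_odd q p n : bpair q p n.*2.+1 = p n.
Proof. by rewrite /bpair /= odd_double uphalf_double. Qed.

Definition paired (q w : nat -> nat) : Prop := exists p, w = bpair q p.

(** Having limit [u] means being equal to [u] from some stage [a] on. *)
Lemma limit_decidable G g : Comp3 G ->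
  (forall i n, exists T, forall t, T <= t -> G i n t = g i n) ->
  exists2 e, Comp1 e & forall i n u,
    jump (jump (fun=> 0)) (e (triple i n u)) = (g i n == u) :> nat.
Proof.
move=> hG lim.
pose v1 z := code_head z; pose v2 z := code_head (code_tail z).
pose v3 z := code_head (code_tail (code_tail z)).
have [|e he1 he2] := @double_jump (fun z a t => G (v1 z) (v2 z) (a + t) == v3 z).
  by move=> D b e1 e2 e3 h1 h2 h3; rewrite /v1 /v2 /v3; comp.
exists e => // i n u; rewrite he2 /v1 /v2 /v3 /triple !code_tailK !code_consK.
have [T hT] := lim i n; congr nat_of_bool.
apply/asboolP/eqP => [[a ha]|<-].
  by have := ha T; rewrite hT ?leq_addl // eqb0 negbK => /eqP.
by exists T => t; rewrite hT ?leq_addr // eqxx.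
Qed.

(* The pair [i], [j] witnesses that [m] is too small as a modulus for [n].  The
   quotients [a / b] are distances with errors [2^-m] and [2^-n]: the first test
   holds if [d < 2^-m] and gives [d <= 3 * 2^-m]; the second one holds only if
   [d > 3 * 2^-n], and its failure gives [d <= 5 * 2^-n]. *)
Definition violates (aX bX aY bY : nat -> nat -> nat -> nat) (g : nat -> nat -> nat)
    (n m i j : nat) : bool :=
  (aX i j m * 2 ^ m <= 2 * bX i j m) &&
  ~~ (aY (g i n) (g j n) n * 2 ^ n <= 4 * bY (g i n) (g j n) n).

(** The number [a] codes the pair [i], [j] together with a stage from which all approximations to
    [violates] are correct. *)
Lemma modulus_decidable aX bX aY bY (MX NX MY NY : machine) G g : Comp3 G ->
  (forall i n, exists T, forall t, T <= t -> G i n t = g i n) ->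
  (forall i j k, exists T, forall t, T <= t -> value MX 0 (triple i j k) t = aX i j k) ->
  (forall i j k, exists T, forall t, T <= t -> value NX 0 (triple i j k) t = bX i j k) ->
  (forall i j k, exists T, forall t, T <= t -> value MY 0 (triple i j k) t = aY i j k) ->
  (forall i j k, exists T, forall t, T <= t -> value NY 0 (triple i j k) t = bY i j k) ->
  exists2 e, Comp1 e & forall n m,
    jump (jump (fun=> 0)) (e (code_cons n m)) =
      `[< exists i j, violates aX bX aY bY g n m i j >] :> nat.
Proof.
move=> hG limG lim1 lim2 lim3 lim4.
pose approx n m i j t :=
  violates (fun i j k => value MX 0 (triple i j k) t) (fun i j k => value NX 0 (triple i j k) t)
    (fun i j k => value MY 0 (triple i j k) t) (fun i j k => value NY 0 (triple i j k) t)
    (fun i n => G i n t) n m i j.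
have [|e he1 he2] := @double_jump (fun z a t =>
   approx (code_head z) (code_tail z) (code_head a) (code_head (code_tail a))
     (code_tail (code_tail a) + t)).
  move=> D b e1 e2 e3 h1 h2 h3; rewrite /approx /violates; comp.
exists e => // n m; rewrite he2 code_consK code_tailK; congr nat_of_bool.
have lim i j : exists T, forall t, T <= t -> approx n m i j t = violates aX bX aY bY g n m i j.
  have [T1 h1] := limG i n; have [T2 h2] := limG j n.
  have [T3 h3] := lim1 i j m; have [T4 h4] := lim2 i j m.
  (* The arguments [G i n t] and [G j n t] of the distance in [Y] vary with [t] too; they equal
     [g i n] and [g j n] past [T1] and [T2]. *)
  have [T5 h5] := lim3 (g i n) (g j n) n; have [T6 h6] := lim4 (g i n) (g j n) n.
  exists (T1 + T2 + T3 + T4 + T5 + T6) => t le_t.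
  by rewrite /approx /violates h1 ?h2 ?h3 ?h4 ?h5 ?h6 //; lia.
apply: asbool_equiv_eq; split=> [[a ha]|[i [j hij]]].
  exists (code_head a), (code_head (code_tail a)).
  have [T hT] := lim (code_head a) (code_head (code_tail a)).
  rewrite -(hT (code_tail (code_tail a) + T)) ?leq_addl //.
  by have := ha T; rewrite eqb0 negbK.
have [T hT] := lim i j; exists (code_cons i (code_cons j T)) => t.
by rewrite !code_tailK !code_consK hT ?hij ?leq_addr.
Qed.

Theorem theorem6p6 (R : realType) (X Y : metricType R)
    (alpha : nat -> X) (beta : nat -> Y) (f : X -> Y) :
  computable_metric_space alpha ->
  computable_metric_space beta ->
  limit_computable_map alpha beta f ->
  unif_continuous f ->
  computable_map_relative_to (jump (jump (fun _ => 0))) alpha beta f.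
Proof.
move=> [_ [sX [aX [bX [_ caX cbX dX]]]]] [_ [sY [aY [bY [_ caY cbY dY]]]]].
move=> [F [MF hMF] hF] uf; set q := jump _.
have /choice[g hg] : forall i, exists r : nat -> nat,
    F (fun=> i) = Some r /\ cauchy_rep beta r (f (alpha i)).
  by move=> i; have [r h1 h2] := hF _ _ (cauchy_rep_const alpha i); exists r.
have limG i n : exists T, forall t, T <= t -> value MF i n t = g i n.
  by apply: value_limit; apply: hMF; have [] := hg i.
have [MX lim1] := fun3_limit caX; have [NX lim2] := fun3_limit cbX.
have [MY lim3] := fun3_limit caY; have [NY lim4] := fun3_limit cbY.
have [e1 ce1 he1] := modulus_decidable (Comp3_value MF) limG lim1 lim2 lim3 lim4.
have [e2 ce2 he2] := limit_decidable (Comp3_value MF) limG.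
rewrite -/q in he1 he2.
have approxX i j k :
    (`|(aX i j k)%:R / (bX i j k)%:R - mdist (alpha i) (alpha j)| <= 2 ^- k :> R)%R.
  have [_ h] := dX i j k; apply: (@approx_unsigned _ (sX i j k)); last by rewrite mulrA.
    by rewrite divr_ge0.
  exact: mdist_ge0.
have approxY i j k :
    (`|(aY i j k)%:R / (bY i j k)%:R - mdist (beta i) (beta j)| <= 2 ^- k :> R)%R.
  have [_ h] := dY i j k; apply: (@approx_unsigned _ (sY i j k)); last by rewrite mulrA.
    by rewrite divr_ge0.
  exact: mdist_ge0.
pose good n m := forall i j, ~~ violates aX bX aY bY g n m i j.
have goodE n m : q (e1 (code_cons n m)) = 0 <-> good n m.
  rewrite he1; split=> [h i j|h].
    by apply/negP => hij; move: h; rewrite asboolT //; exists i, j.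
  by rewrite asboolF // => -[i [j]]; apply/negP.
have ex_good n : exists m, q (e1 (code_cons n m)) == 0.
  (* Passing the first test gives distance at most [3 * 2 ^- m], hence images closer than [2 ^- n],
     entries closer than [3 * 2 ^- n], and a quotient at most [4 * 2 ^- n]. *)
  have [m hm] := modulus_exists n uf; exists m; apply/eqP/goodE => i j.
  apply/negP => /andP[near_ij]; apply/negP; rewrite negbK.
  rewrite (ratio_test R) ?(dY _ _ _).1 //.
  move: near_ij; rewrite (ratio_test R) ?(dX _ _ _).1 // => near_ij.
  have lt_f : (mdist (f (alpha i)) (f (alpha j)) < 2 ^- n :> R)%R.
    by apply: hm; have := approxX i j m; rewrite ler_norml => /andP[]; lra.
  have := approxY (g i n) (g j n) n; rewrite ler_norml => /andP[].
  have := metric_triangle (beta (g i n)) (f (alpha i)) (beta (g j n)).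
  have := metric_triangle (f (alpha i)) (f (alpha j)) (beta (g j n)).
  rewrite (metric_sym (beta (g i n)) (f _)).
  have := cauchy_rep_dist n (hg i).2; have := cauchy_rep_dist n (hg j).2.
  lra.
pose mo n := ex_minn (ex_good n).
have mo_good n i j : (mdist (alpha i) (alpha j) < 2 ^- mo n ->
    mdist (f (alpha i)) (f (alpha j)) <= 7 * 2 ^- n :> R)%R.
  (* Conversely, points closer than [2 ^- m] pass the first test. The quotient for [Y] is then at
     most [4 * 2 ^- n], the entries are within [5 * 2 ^- n] and the images within [7 * 2 ^- n]. *)
  rewrite /mo; case: ex_minnP => m /eqP/goodE gm _ lt_m.
  have near_ij : aX i j m * 2 ^ m <= 2 * bX i j m.
    rewrite (ratio_test R) ?(dX _ _ _).1 //.
    by have := approxX i j m; rewrite ler_norml => /andP[]; lra.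
  have := gm i j; rewrite /violates near_ij /= negbK.
  rewrite (ratio_test R) ?(dY _ _ _).1 //.
  have := approxY (g i n) (g j n) n; rewrite ler_norml => /andP[].
  have := metric_triangle (f (alpha i)) (beta (g i n)) (f (alpha j)).
  have := metric_triangle (beta (g i n)) (beta (g j n)) (f (alpha j)).
  rewrite (metric_sym (beta (g j n)) (f _)).
  have := cauchy_rep_dist n (hg i).2; have := cauchy_rep_dist n (hg j).2.
  lra.
(* The odd positions of the input carry the name of [x], the even ones the oracle. *)
pose u (w : nat -> nat) k := g (w (mo (k + 5)).*2.+1) (k + 5).
have cEven b e h : Comp (paired q) b e -> Comp1 h ->
    Comp (paired q) b (fun w s => q (h (e w s))).
  move=> he hh; apply: (Comp_ext (e := fun w s => w (h (e w s) + h (e w s)))).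
    by move=> w s [p ->]; rewrite addnn bpair_even.
  by apply: Comp_oracle; comp.
have cOdd b e : Comp (paired q) b e ->
    Comp (paired q) b (fun w s => w (e w s).*2.+1).
  move=> he; apply: (Comp_ext (e := fun w s => w (e w s + e w s).+1)).
    by move=> w s _; rewrite addnn.
  by apply: Comp_oracle; comp.
have cMo b e : Comp (paired q) b e -> Comp (paired q) b (fun w s => mo (e w s)).
  move=> he; apply: (Comp_mu (F := fun w s x => q (e1 (code_cons (e w s) x)))).
    move=> b' ex le_b hx; apply: cEven => //; comp.
  move=> w s _; rewrite /mo; case: ex_minnP => m /eqP hm minm; split=> // x hx.
  by apply: minm; apply/eqP.
have cg b ei en : Comp (paired q) b ei -> Comp (paired q) b en ->
    Comp (paired q) b (fun w s => g (ei w s) (en w s)).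
  move=> hi hn.
  (* The search is for a zero, so the oracle's answer is inverted; [g] takes the only value
     accepted. *)
  apply: (Comp_mu (F := fun w s x => 1 - q (e2 (triple (ei w s) (en w s) x)))).
    move=> b' ex le_b hx; apply: (comp2 (f := subn)); first exact: Comp_const.
    by apply: cEven => //; comp.
  move=> w s _; split=> [|x]; first by rewrite he2 eqxx.
  by rewrite he2; case: eqP => // ->.
have [M oneM hM] : exists2 M : machine, one_way M &
    forall w, paired q w -> produces M w (u w).
  apply: computes_sequence => b e he; apply: cg; last by comp.
  by apply: (cOdd b (fun w s => mo (e w s + 5))); apply: cMo; comp.
exists (fun p => Some (u (bpair q p))) => [|p x hp].
  (* The computable function is restricted to inputs containing the oracle [q], where the machine is
     known to be correct. *)
  exists (fun w => if `[< paired q w >] then Some (u w) else None).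
    exists M => // w r; case: asboolP => // hw [<-]; exact: hM.
  by move=> p r [<-]; rewrite asboolT //; exists p.
exists (u (bpair q p)) => //.
have -> : u (bpair q p) = (fun k => g (p (mo (k + 5))) (k + 5)).
  by apply/funext => k; rewrite /u bpair_odd.
by apply: cauchy_output hp => // i; have [] := hg i.
Qed.
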